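(* Let $\alpha>1$ and $\rho=(\alpha-1)/2$. Put $$r_\alpha(t)=\zeta(1+t)^\alpha-1-t^{-\alpha},\qquad t>0,$$ let $R_\alpha$ be the integral operator on $L^2(\mathbb R_+)$ with kernel $(xy)^\rho r_\alpha(x+y)$, and define the differential operator $$P_\rho=\frac{d}{dx}-\frac{\rho}{x}.$$ For every integer $N\ge1$ and every $0\le\delta<\alpha/2$, if $u\in L^2(\mathbb R_+)$ satisfies $x^{-N+1-\delta}u\in L^2(\mathbb R_+)$, then $$x^{-\delta}P_\rho^NR_\alpha u\in L^2(\mathbb R_+).$$ Moreover, $x^NP_\rho^NR_\alpha$ is bounded on $L^2(\mathbb R_+)$ for every integer $N\ge1$.
   Context: $\mathbb R_+=(0,\infty)$; $\zeta$ is the Riemann zeta function; $x^\gamma$ denotes multiplication by the function $x\mapsto x^\gamma$. *)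

(* Defs.v *)
From HB Require Import structures.
From mathcomp Require Import all_boot all_order all_algebra.
From mathcomp Require Import complex.
From mathcomp Require Import all_classical all_reals all_analysis.

Set Implicit Arguments.
Unset Strict Implicit.
Unset Printing Implicit Defensive.

Import Order.TTheory GRing.Theory Num.Theory.
Import numFieldNormedType.Exports.

Local Open Scope classical_set_scope.
Local Open Scope ring_scope.
Local Open Scope complex_scope.

Section Defs.
Variable R : realType.
Implicit Types (f u : R -> R[i]) (w : R -> R) (alpha rho s t x : R).

Definition Rpos : set R := `]0, +oo[.

(* Dirichlet series; meaningful for s > 1 only. *)
Definition zeta s : R := limn (series (fun n : nat => (n.+1)%:R `^ (- s))).

Definition r alpha t : R := zeta (1 + t) `^ alpha - 1 - t `^ (- alpha).

(* An element of L^2(R_+) is represented by a complex-valued function of which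
   only the values on R_+ matter. R[i] carries no normed R-module structure, so
   measurability, integrals and derivatives are taken componentwise. *)
Definition L2norm u : \bar R :=
  Lnorm lebesgue_measure 2%:E ((fun x => (Normc.normc (u x))%:E) \_ Rpos).

Definition L2 u : Prop :=
  [/\ measurable_fun Rpos (fun x => complex.Re (u x)),
      measurable_fun Rpos (fun x => complex.Im (u x)) &
      (L2norm u < +oo)%E].

Definition cintegral f : R[i] :=
  (\int[lebesgue_measure]_(y in Rpos) complex.Re (f y)) +i*
  (\int[lebesgue_measure]_(y in Rpos) complex.Im (f y)).

Definition cderivable f x : Prop :=
  derivable (fun y => complex.Re (f y)) x 1 /\
  derivable (fun y => complex.Im (f y)) x 1.

Definition cderive f x : R[i] :=
  derive1 (fun y => complex.Re (f y)) x +i*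
  derive1 (fun y => complex.Im (f y)) x.

Definition mulop w f : R -> R[i] := fun x => (w x)%:C * f x.

Definition Rop alpha rho u : R -> R[i] := fun x =>
  cintegral (fun y => ((x * y) `^ rho * r alpha (x + y))%:C * u y).

Definition P rho f : R -> R[i] := fun x =>
  cderive f x - (rho / x)%:C * f x.

(* The classical derivatives occurring in P_rho^N f all exist on R_+; without
   this, [iter N (P rho) f] could be a junk value. *)
Definition Pdom rho (N : nat) f : Prop :=
  forall k : nat, (k < N)%N -> forall x, 0 < x -> cderivable (iter k (P rho) f) x.

End Defs.

(* Main.v *)
Require Import Defs.
From HB Require Import structures.
From mathcomp Require Import all_boot all_order all_algebra.
From mathcomp Require Import complex ring lra.
From mathcomp Require Import all_classical all_reals all_analysis.
From mathcomp Require Import measurable_realfun.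

Set Implicit Arguments.
Unset Strict Implicit.
Unset Printing Implicit Defensive.

Import Order.TTheory GRing.Theory Num.Theory.
Import numFieldNormedType.Exports.

Local Open Scope classical_set_scope.
Local Open Scope ring_scope.

(* Since [P_rho (x^rho f) = x^rho f'], the function [P_rho^N R_alpha u] is
   [x^rho] times the integral of [y^rho r^(N)(x + y) u(y)]. Everything then rests
   on the symbol estimates [r^(N)(t) = O(t^(-alpha-N))] and [O(t^(1-alpha-N))] on
   the whole half-line: they turn both claims into the L^2-boundedness of the
   homogeneous kernels [x^a y^b (x + y)^(-a-b-1)] with [a, b > -1/2], which is
   Schur's test with the weight [y^(-1/2)]. The estimates come from writing
   [zeta (1 + t)] as [(1 + t)] times the Laplace transform of
   [floor(e^y) e^(-y)]: near 0 one compares with [1/t], and [r + 1] is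
   [t^(-alpha) ((t zeta(1 + t))^alpha - 1)], while at infinity one subtracts 1
   and the remaining density vanishes on [0, ln 2[. *)

(** * Integrals over the half-line *)

(** A homogeneous kernel must have degree exactly -1 to act on L^2, which is why two bounds on [r]
    are needed. If the output carries the weight [x^g] and the input lies in [y^e L^2], the
    exponents are [a = rho + g] and [b = rho + e], and [2 * rho = alpha - 1] gives
    [a + b + 1 = alpha + g + e]. The first claim has [g + e = N - 1], the second [g + e = N]. The
    power gained in the first comes from the cancellation of [t^(-alpha)] near 0, and
    [delta < alpha / 2] says exactly [a > -1/2]. The obstacle is that [alpha] is real and
    derivatives of every order must be controlled, while [zeta] is only a series. Symbol classes are
    closed under products and under real powers of functions lying between 1 and a constant; this
    leaves two Laplace transforms to estimate, and differentiating those only inserts powers of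
    [- y]. *)

Section half_line_integrals.
Variable R : realType.
Implicit Types (f F : R -> R) (a b p q s t x y M : R).
Notation mu := (@lebesgue_measure R).

Lemma RposE x : Rpos x = (0 < x) :> Prop.
Proof. by rewrite /Rpos /= in_itv /= andbT. Qed.

Lemma measurable_Rpos : measurable (@Rpos R : set (measurableTypeR R)).
Proof. exact: measurable_itv. Qed.

Lemma measurable_fun_Rpos f :
  (forall y, 0 < y -> derivable f y 1) -> measurable_fun (@Rpos R) f.
Proof.
move=> df; apply: open_continuous_measurable_fun; first exact: interval_open.
move=> y; rewrite inE RposE => y0.
by apply/differentiable_continuous/derivable1_diffP/df.
Qed.

(** Monotone convergence along compact intervals. Bounding the increments of [F] uniformly replaces
    the computation of its limits at 0 and at infinity. *)
Lemma integral_Rpos_le_primitive f F M :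
  (forall y, 0 < y -> 0 <= f y) ->
  (forall y, 0 < y -> {for y, continuous f}) ->
  (forall y, 0 < y -> is_derive y 1 F (f y)) ->
  (forall a b, 0 < a -> a < b -> F b - F a <= M) ->
  (\int[mu]_(y in @Rpos R) (f y)%:E <= M%:E)%E.
Proof.
move=> f0 cf dF FM.
(* With [n.+2] the endpoints are already distinct at [n = 0], as the fundamental theorem of calculus
   requires. *)
pose A (n : nat) := [set` `[n.+2%:R^-1 : R, n.+2%:R]].
have n0 n : (0 : R) < n.+2%:R^-1 by rewrite invr_gt0.
have Apos n y : A n y -> 0 < y.
  by rewrite /A /= in_itv /= => /andP[+ _]; exact: lt_le_trans.
have mfA n : measurable_fun (A n) (EFin \o f).
  apply/measurable_EFinP; apply: (@measurable_funS _ _ _ _ (@Rpos R)).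
  - exact: measurable_Rpos.
  - by move=> y /Apos; rewrite RposE.
  - apply: open_continuous_measurable_fun; first exact: interval_open.
    by move=> y; rewrite inE RposE => /cf.
have -> : @Rpos R = \bigcup_n A n.
  apply/seteqP; split => y; last by move=> [n _ /Apos]; rewrite RposE.
  rewrite RposE => y0.
  pose n := maxn (Num.trunc y) (Num.trunc y^-1); exists n => //.
  have h z : 0 < z -> (Num.trunc z <= n)%N -> z <= n.+2%:R.
    move=> z0 zn; apply/ltW/(@lt_le_trans _ _ (Num.trunc z).+1%:R).
      by have /andP[] := truncn_itv (ltW z0).
    by rewrite ler_nat ltnS (leq_trans zn).
  rewrite /A /= in_itv /= h ?leq_maxl// andbT.
  by rewrite invf_ple ?posrE// h ?invr_gt0// leq_maxr.
have ndA : nondecreasing_seq A.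
  apply/nondecreasing_seqP => n; rewrite subsetEset => y; rewrite /A /= !in_itv /=.
  move=> /andP[ay yb]; apply/andP; split.
    by apply: le_trans ay; rewrite lef_pV2 ?posrE// ler_nat.
  by apply: le_trans yb _; rewrite ler_nat.
have mA n : measurable (A n) by exact: measurable_itv.
have A0 n y : A n y -> (0 <= (EFin \o f) y)%E by move=> /Apos /f0; rewrite lee_fin.
have cvA := ge0_nondecreasing_set_cvg_integral (mu := mu) ndA mA mfA A0.
apply: (cvge_to_le cvA).
apply: nearW => n.
have ab : n.+2%:R^-1 < n.+2%:R :> R.
  by apply: (@lt_trans _ _ 1); rewrite ?invf_lt1 ?ltr1n ?ltr0n.
rewrite (@continuous_FTC2 _ f F)//.
- by rewrite -EFinB lee_fin FM.
- apply: continuous_in_subspaceT => y; rewrite inE => /Apos; exact: cf.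
- have cF y : 0 < y -> {for y, continuous F}.
    move=> y0; apply/differentiable_continuous/derivable1_diffP.
    by have [] := dF _ y0.
  split.
  + move=> y; rewrite in_itv /= => /andP[ay _].
    by have [] := dF y (lt_trans (n0 n) ay).
  + exact/cvg_at_right_filter/cF.
  + by apply/cvg_at_left_filter/cF; rewrite ltr0n.
- move=> y; rewrite in_itv /= => /andP[ay _].
  by have [_] := dF y (lt_trans (n0 n) ay); rewrite derive1E.
Qed.

Lemma gt0_powRD x a b : 0 < x -> x `^ (a + b) = x `^ a * x `^ b.
Proof. by move=> x0; rewrite powRD ?(gt_eqF x0) ?implybT. Qed.

Lemma powR_subr1 a x : 0 < x -> x `^ (a - 1) * x = x `^ a.
Proof.
move=> x0; rewrite -[X in _ * X](powRr1 (ltW x0)) -gt0_powRD//.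
by rewrite subrK.
Qed.

(** The constant 2 is uniform in [a]. The exponents met below are [1 - p] and [1 - q], which stay
    under 1 for positive [p] and [q]. *)
Lemma ler_powR_doubling s t a : 0 < t -> t <= s -> s <= 2 * t -> a <= 1 ->
  s `^ a <= 2 * t `^ a.
Proof.
move=> t0 ts s2t a1; have s0 := lt_le_trans t0 ts.
have [a0|a0] := leP 0 a.
  apply: (@le_trans _ _ ((2 * t) `^ a)).
    by rewrite ge0_ler_powR ?nnegrE ?mulr_ge0 ?(ltW s0) ?(ltW t0).
  rewrite powRM ?(ltW t0)// ler_wpM2r ?powR_ge0//.
  by rewrite ler1_powR// ler1n.
apply: (@le_trans _ _ (t `^ a)); last by rewrite ler_peMl ?powR_ge0 ?ler1n.
rewrite -[a]opprK !(powRN _ (- a)) lef_pV2 ?posrE ?powR_gt0//.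
by rewrite ge0_ler_powR ?nnegrE ?oppr_ge0 ?(ltW a0) ?(ltW s0) ?(ltW t0).
Qed.

(* The beta integral: in the variable [y / (x + y)], the integrand is dominated
   by twice the sum of its two endpoint singularities. *)
Lemma beta_integral_le p q x : 0 < p -> 0 < q -> 0 < x ->
  (\int[mu]_(y in @Rpos R) (y `^ (p - 1) * (x + y) `^ (- p - q))%:E <=
   (2 * (p^-1 + q^-1) * x `^ (- q))%:E)%E.
Proof.
move=> p0 q0 x0.
(* With [s = y / (x + y)], the integrand is [x^(-q) s^(p-1) (1-s)^(q-1) ds]. The two terms of [g]
   are, up to the factor 2, [x^(-q) s^(p-1) ds] and [x^(-q) (1-s)^(q-1) ds], and [G] is a primitive
   of [g]. *)
pose g y : R := 2 * (x `^ (1 - q) * y `^ (p - 1) * (x + y) `^ (- p - 1) +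
                 (x + y) `^ (- q - 1)).
pose G y : R := 2 * (p^-1 * x `^ (- q) * (y `^ p * (x + y) `^ (- p)) -
                 q^-1 * (x + y) `^ (- q)).
have dpow c y : 0 < y -> is_derive y 1 (fun z : R => (x + z) `^ c)
    (c * (x + y) `^ (c - 1)).
  move=> y0; have xy0 : 0 < x + y by rewrite addr_gt0.
  have := @is_derive1_comp R (fun z => z `^ c) (fun z => x + z) y _ _
    (is_derive1_powR c xy0) _.
  move=> /(_ 1); rewrite mulr1; apply.
  by apply: is_derive_eq (is_deriveD (is_derive_cst x y 1) (is_derive_id y 1)) _; rewrite add0r.
have cpow c y : 0 < y -> {for y, continuous (fun z : R => (x + z) `^ c)}.
  move=> y0; apply/differentiable_continuous/derivable1_diffP.
  by have [] := dpow c y y0.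
have cpow' c y : 0 < y -> {for y, continuous (fun z : R => z `^ c)}.
  move=> y0; apply/differentiable_continuous/derivable1_diffP.
  by have [] := is_derive1_powR c y0.
have mf : measurable_fun (@Rpos R) (fun y : R => (y `^ (p - 1) * (x + y) `^ (- p - q))%:E).
  apply/measurable_EFinP; apply: measurable_funM; apply: measurable_fun_Rpos.
    by move=> y y0; have [] := is_derive1_powR (p - 1) y0.
  by move=> y y0; have [] := dpow (- p - q) y y0.
have cg y : 0 < y -> {for y, continuous g}.
  move=> y0; rewrite /g; apply: cvgM; first exact: cvg_cst.
  apply: cvgD; last exact: cpow.
  apply: cvgM; last exact: cpow.
  by apply: cvgM; [exact: cvg_cst|exact: cpow'].
have mg : measurable_fun (@Rpos R) (EFin \o g).
  apply/measurable_EFinP; apply: open_continuous_measurable_fun; first exact: interval_open.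
  by move=> y; rewrite inE RposE => /cg.
apply: (@le_trans _ _ (\int[mu]_(y in @Rpos R) (g y)%:E)%E).
  apply: ge0_le_integral => //; first exact: measurable_Rpos.
    by move=> y _; rewrite lee_fin mulr_ge0 ?powR_ge0.
  move=> y; rewrite RposE => y0; rewrite lee_fin.
  have xy0 : 0 < x + y by rewrite addr_gt0.
  (* The cut is at [s = 1/2]: on either side the factor that is not singular there is at most 2. *)
  have [xy|yx] := leP x y.
    apply: (@le_trans _ _ (2 * (x + y) `^ (- q - 1))); last first.
      by rewrite /g ler_pM2l// lerDr !mulr_ge0 ?powR_ge0.
    have -> : - q - 1 = (p - 1) + (- p - q) by ring.
    rewrite (gt0_powRD (p - 1) (- p - q))// mulrA ler_pM2r ?powR_gt0//.
    have : (x + y) `^ (1 - p) <= 2 * y `^ (1 - p).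
      by apply: ler_powR_doubling => //; lra.
    have -> : 1 - p = - (p - 1) by ring.
    by rewrite !powRN ler_pdivlMr ?powR_gt0// mulrC ler_pdivrMr ?powR_gt0.
  apply: (@le_trans _ _ (2 * (x `^ (1 - q) * y `^ (p - 1) * (x + y) `^ (- p - 1)))); last first.
    by rewrite /g ler_pM2l// lerDl powR_ge0.
  have -> : - p - q = (1 - q) + (- p - 1) by ring.
  rewrite (gt0_powRD (1 - q) (- p - 1))// mulrA mulrA ler_pM2r ?powR_gt0//.
  rewrite mulrA [leLHS]mulrC ler_pM2r ?powR_gt0//.
  by apply: ler_powR_doubling => //; lra.
apply: (@integral_Rpos_le_primitive g G); [|exact: cg| |].
- by move=> y y0; rewrite /g !(mulr_ge0, addr_ge0) ?powR_ge0.
- move=> y y0; have xy0 : 0 < x + y by rewrite addr_gt0.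
  have h1 := is_derive1_powR p y0; have h2 := dpow (- p) y y0.
  have h3 := dpow (- q) y y0.
  rewrite /G; apply: is_derive_eq; rewrite /g /GRing.scale /=.
  have -> : 1 - q = - q + 1 by ring.
  rewrite (gt0_powRD (- q) 1 x0) powRr1 ?(ltW x0)//.
  rewrite -(powR_subr1 p y0) -(powR_subr1 (- p) xy0).
  field.
  by rewrite !gt_eqF.
- move=> a b a0 ab; have b0 := lt_trans a0 ab.
  have xa0 : 0 < x + a by rewrite addr_gt0.
  have xb0 : 0 < x + b by rewrite addr_gt0.
  have H1 : b `^ p * (x + b) `^ (- p) <= 1.
    rewrite powRN ler_pdivrMr ?powR_gt0// mul1r ge0_ler_powR ?nnegrE ?(ltW p0) ?(ltW b0) ?(ltW xb0)//.
    by rewrite lerDr ltW.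
  have H2 : 0 <= a `^ p * (x + a) `^ (- p) by rewrite mulr_ge0 ?powR_ge0.
  have H3 : (x + a) `^ (- q) <= x `^ (- q).
    rewrite !powRN lef_pV2 ?posrE ?powR_gt0// ge0_ler_powR ?nnegrE ?(ltW q0) ?(ltW x0) ?(ltW xa0)//.
    by rewrite lerDl ltW.
  have H4 := powR_ge0 (x + b) (- q).
  have pq1 : 0 < p^-1 by rewrite invr_gt0.
  have pq2 : 0 < q^-1 by rewrite invr_gt0.
  have xq : 0 < x `^ (- q) by rewrite powR_gt0.
  have px : 0 < p^-1 * x `^ (- q) by rewrite mulr_gt0.
  rewrite /G -mulrBr -[leRHS]mulrA ler_pM2l//.
  move: H1 H2 px; set u := b `^ p * _; set v := a `^ p * _; set w := p^-1 * _.
  move=> H1 H2 px; rewrite mulrDl -/w.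
  have : w * u <= w by rewrite ler_piMr ?(ltW px).
  have : 0 <= w * v by rewrite mulr_ge0 ?(ltW px).
  have : q^-1 * (x + a) `^ (- q) <= q^-1 * x `^ (- q) by rewrite ler_pM2l.
  have : 0 <= q^-1 * (x + b) `^ (- q) by rewrite mulr_ge0 ?(ltW pq2).
  lra.
Qed.

End half_line_integrals.

Arguments measurable_Rpos {R}.

(** * Schur's test for homogeneous kernels *)

Section hilbert_kernel.
Variable R : realType.
Implicit Types (a b c x y : R) (v F : R -> R).
Notation mu := (@lebesgue_measure R).

Definition hilbert_kernel a b x y : R := x `^ a * y `^ b * (x + y) `^ (- a - b - 1).

(** The constant of the beta integral at [p = b + 1/2], [q = a + 1/2]. It is symmetric in [a] and
    [b], so it also serves the transposed kernel. *)
Definition hilbert_const a b : R := 2 * ((a + 2^-1)^-1 + (b + 2^-1)^-1).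

Lemma hilbert_kernel_ge0 a b x y : 0 <= hilbert_kernel a b x y.
Proof. by rewrite !mulr_ge0 ?powR_ge0. Qed.

Lemma hilbert_const_gt0 a b : - 2^-1 < a -> - 2^-1 < b -> 0 < hilbert_const a b.
Proof.
by move=> a0 b0; rewrite mulr_gt0// addr_gt0// invr_gt0 -ltrBlDr sub0r.
Qed.

Lemma measurable_powR_Rpos a : measurable_fun (@Rpos R) (fun y => y `^ a).
Proof. by apply: measurable_funTS; exact: measurable_powR. Qed.

Lemma measurable_powR_shift a x : measurable_fun (@Rpos R) (fun y => (x + y) `^ a).
Proof.
apply: measurable_funTS; apply: (measurableT_comp (measurable_powR _)).
by apply: measurable_funD; [exact: measurable_cst|exact: measurable_id].
Qed.

Lemma measurable_hilbert_kernel a b x :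
  measurable_fun (@Rpos R) (hilbert_kernel a b x).
Proof.
apply: measurable_funM; last exact: measurable_powR_shift.
by apply: measurable_funM; [exact: measurable_cst|exact: measurable_powR_Rpos].
Qed.

(** The kernel has degree -1, so it maps [y^(-1/2)] to a multiple of [x^(-1/2)]. Convergence at
    [y = 0] needs [b > -1/2], and convergence at infinity needs [a > -1/2]. *)
Lemma hilbert_kernel_test a b x : - 2^-1 < a -> - 2^-1 < b -> 0 < x ->
  (\int[mu]_(y in @Rpos R) (hilbert_kernel a b x y * y `^ (- 2^-1))%:E <=
   (hilbert_const a b * x `^ (- 2^-1))%:E)%E.
Proof.
move=> a0 b0 x0; have p0 : 0 < b + 2^-1 by rewrite -ltrBlDr sub0r.
have q0 : 0 < a + 2^-1 by rewrite -ltrBlDr sub0r.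
rewrite (@eq_integral _ _ _ mu _ (fun y => (x `^ a)%:E *
  (y `^ (b + 2^-1 - 1) * (x + y) `^ (- (b + 2^-1) - (a + 2^-1)))%:E)%E); last first.
  move=> y; rewrite inE RposE => y0; rewrite -EFinM; congr EFin.
  have -> : b + 2^-1 - 1 = b + - 2^-1 by lra.
  have -> : - (b + 2^-1) - (a + 2^-1) = - a - b - 1 by lra.
  by rewrite (gt0_powRD b)// /hilbert_kernel; ring.
rewrite ge0_integralZl_EFin ?powR_ge0//; last 3 first.
- exact: measurable_Rpos.
- by move=> y _; rewrite lee_fin mulr_ge0 ?powR_ge0.
- apply/measurable_EFinP; apply: measurable_funM; first exact: measurable_powR_Rpos.
  exact: measurable_powR_shift.
apply: le_trans (lee_wpmul2l _ (beta_integral_le p0 q0 x0)) _.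
  by rewrite lee_fin powR_ge0.
rewrite -EFinM lee_fin /hilbert_const mulrCA -gt0_powRD//.
have -> : a - (a + 2^-1) = - 2^-1 by lra.
by rewrite [(b + _)^-1 + _]addrC.
Qed.

(* Schur's test with the weight [y^(-1/2)]; the Cauchy-Schwarz step is AM-GM
   with the optimal parameter [F x * x^(1/2) / hilbert_const a b]. *)
Lemma hilbert_kernel_sqr_le a b x v Fx : - 2^-1 < a -> - 2^-1 < b -> 0 < x ->
  measurable_fun (@Rpos R) v -> (forall y, 0 < y -> 0 <= v y) -> 0 <= Fx ->
  (Fx%:E <= \int[mu]_(y in @Rpos R) (hilbert_kernel a b x y * v y)%:E)%E ->
  ((Fx ^+ 2)%:E <= (hilbert_const a b * x `^ (- 2^-1))%:E *
    \int[mu]_(y in @Rpos R) (hilbert_kernel a b x y * (y `^ 2^-1 * v y ^+ 2))%:E)%E.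
Proof.
move=> a0 b0 x0 mv v0; set c := hilbert_const a b; have c0 : 0 < c by exact: hilbert_const_gt0.
set B := (\int[mu]_(y in _) (hilbert_kernel a b x y * (_ * _))%:E)%E.
have pos1 y : 0 <= hilbert_kernel a b x y * y `^ (- 2^-1).
  by rewrite mulr_ge0 ?hilbert_kernel_ge0 ?powR_ge0.
have pos2 y : 0 <= hilbert_kernel a b x y * (y `^ 2^-1 * v y ^+ 2).
  by apply: mulr_ge0; [exact: hilbert_kernel_ge0|apply: mulr_ge0; [exact: powR_ge0|exact: sqr_ge0]].
have B0 : (0 <= B)%E.
  by apply: integral_ge0 => y _; rewrite lee_fin pos2.
have xh : 0 < x `^ (- 2^-1) by rewrite powR_gt0.
(* The parameter [l] is a positive multiple of [Fx] and gets inverted, so [Fx = 0] is settled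
   apart. *)
rewrite le_eqVlt => /predU1P[<- _|F0 FK].
  by rewrite expr0n mule_ge0// lee_fin mulr_ge0 ?(ltW c0) ?(ltW xh).
pose l := Fx / (c * x `^ (- 2^-1)).
have l0 : 0 < l by rewrite divr_gt0// mulr_gt0.
have mk := measurable_hilbert_kernel a b x.
have mh1 : measurable_fun (@Rpos R) (fun y => (hilbert_kernel a b x y * y `^ (- 2^-1))%:E).
  by apply/measurable_EFinP; apply: measurable_funM => //; exact: measurable_powR_Rpos.
have mh2 : measurable_fun (@Rpos R)
    (fun y => (hilbert_kernel a b x y * (y `^ 2^-1 * v y ^+ 2))%:E).
  apply/measurable_EFinP; apply: measurable_funM => //; apply: measurable_funM.
    exact: measurable_powR_Rpos.
  exact: measurable_funX.
have mD := @measurable_Rpos R.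
have : (Fx%:E <= (l / 2)%:E * (c * x `^ (- 2^-1))%:E + ((2 * l)^-1)%:E * B)%E.
  apply: (le_trans FK).
  apply: (@le_trans _ _ (\int[mu]_(y in @Rpos R)
     ((l / 2)%:E * (hilbert_kernel a b x y * y `^ (- 2^-1))%:E +
      ((2 * l)^-1)%:E * (hilbert_kernel a b x y * (y `^ 2^-1 * v y ^+ 2))%:E))%E).
    apply: ge0_le_integral => //.
    - move=> y; rewrite RposE => y0.
      by rewrite lee_fin mulr_ge0 ?hilbert_kernel_ge0 ?v0.
    - by apply/measurable_EFinP; exact: measurable_funM.
    - by apply: emeasurable_funD; exact: measurable_funeM.
    - move=> y; rewrite RposE => y0; rewrite -!EFinM -EFinD lee_fin.
      have z0 : 0 < y `^ 2^-1 by rewrite powR_gt0.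
      rewrite powRN; move: z0; set z := y `^ 2^-1; set K := hilbert_kernel _ _ _ _ => z0.
      (* AM-GM with its defect written as an explicit square. *)
      have -> : l / 2 * (K * z^-1) + (2 * l)^-1 * (K * (z * v y ^+ 2)) =
          K * (v y + (l - z * v y) ^+ 2 / (2 * l * z)).
        by field; rewrite !gt_eqF.
      apply: ler_wpM2l; first exact: hilbert_kernel_ge0.
      rewrite lerDl; apply: divr_ge0; first exact: sqr_ge0.
      by apply: ltW; apply: mulr_gt0 z0; exact: mulr_gt0.
  rewrite ge0_integralD//; last 4 first.
  - by move=> y _; rewrite -EFinM lee_fin mulr_ge0// divr_ge0// ltW.
  - exact: measurable_funeM.
  - by move=> y _; rewrite -EFinM lee_fin mulr_ge0// invr_ge0 mulr_ge0// ltW.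
  - exact: measurable_funeM.
  rewrite ge0_integralZl_EFin//; last 2 first.
  - by move=> y _; rewrite lee_fin.
  - by rewrite divr_ge0// ltW.
  rewrite ge0_integralZl_EFin//; last 2 first.
  - by move=> y _; rewrite lee_fin.
  - by rewrite invr_ge0 mulr_ge0// ltW.
  apply: leeD2r; apply: lee_wpmul2l; first by rewrite lee_fin divr_ge0// ltW.
  exact: hilbert_kernel_test.
have -> : ((l / 2)%:E * (c * x `^ (- 2^-1))%:E = (Fx / 2)%:E)%E.
  by rewrite -EFinM; congr EFin; rewrite /l; field; rewrite !gt_eqF.
have cx : 0 < c * x `^ (- 2^-1) by rewrite mulr_gt0.
(* If [B] is infinite the right-hand side is too, its coefficient being positive. If [B] is finite,
   multiplying by [2 * Fx] undoes the choice of [l]. *)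
case: B B0 => [z| |]; last by rewrite leeNy_eq.
  rewrite lee_fin => z0; rewrite -!EFinM -EFinD !lee_fin => h.
  have : 2 * Fx * (Fx / 2) <= 2 * Fx * ((2 * l)^-1 * z).
    by rewrite ler_pM2l ?mulr_gt0//; lra.
  have -> : 2 * Fx * ((2 * l)^-1 * z) = c * x `^ (- 2^-1) * z.
    by rewrite /l; field; rewrite !gt_eqF.
  by apply: le_trans; rewrite le_eqVlt; apply/orP; left; apply/eqP; field.
by move=> _ _; rewrite gt0_muley ?lte_fin// leey.
Qed.

(** The pointwise inequality is integrated in [x] and the order of integration exchanged; the test
    function inequality then applies to the transposed kernel. Taking any [F] dominated by the
    integral lets signed or complex integrals enter through their moduli. *)
Lemma schur_hilbert_kernel a b v F : - 2^-1 < a -> - 2^-1 < b ->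
  measurable_fun (@Rpos R) v -> (forall y, 0 < y -> 0 <= v y) ->
  measurable_fun (@Rpos R) F -> (forall x, 0 < x -> 0 <= F x) ->
  (forall x, 0 < x ->
    ((F x)%:E <= \int[mu]_(y in @Rpos R) (hilbert_kernel a b x y * v y)%:E)%E) ->
  (\int[mu]_(x in @Rpos R) (F x ^+ 2)%:E <=
   (hilbert_const a b ^+ 2)%:E * \int[mu]_(y in @Rpos R) (v y ^+ 2)%:E)%E.
Proof.
move=> a0 b0 mv v0 mF F0 FK.
set c := hilbert_const a b; have c0 : 0 < c by exact: hilbert_const_gt0.
have mD := @measurable_Rpos R.
(* Extension by zero puts [H] on the whole plane, where Tonelli's theorem is applied. The factor
   [x^(-1/2)] of the pointwise inequality is absorbed in [g], and [y^(1/2)] in [h]. *)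
pose g x : R := ((fun x => c * x `^ (a - 2^-1)) \_ (@Rpos R)) x.
pose h y : R := ((fun y => y `^ (b + 2^-1) * v y ^+ 2) \_ (@Rpos R)) y.
have mg : measurable_fun [set: measurableTypeR R] g.
  apply: (measurable_restrictT _ mD).1.
  by apply: measurable_funM; [exact: measurable_cst|exact: measurable_powR_Rpos].
have mh : measurable_fun [set: measurableTypeR R] h.
  apply: (measurable_restrictT _ mD).1.
  by apply: measurable_funM; [exact: measurable_powR_Rpos|exact: measurable_funX].
have g0 x : 0 <= g x.
  by rewrite /g patchE; case: ifP => // _; rewrite mulr_ge0 ?powR_ge0// ltW.
have h0 x : 0 <= h x.
  rewrite /h patchE; case: ifP => // _.
  by apply: mulr_ge0; [exact: powR_ge0|exact: sqr_ge0].
pose H (z : measurableTypeR R * measurableTypeR R) : \bar R :=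
  (g z.1 * h z.2 * (z.1 + z.2) `^ (- a - b - 1))%:E.
have mH : measurable_fun setT H.
  apply/measurable_EFinP; apply: measurable_funM; first apply: measurable_funM.
  - exact: (measurableT_comp mg).
  - exact: (measurableT_comp mh).
  - apply: (measurableT_comp (measurable_powR _)); exact: measurable_funD.
have H0 z : (0 <= H z)%E by rewrite lee_fin !mulr_ge0 ?powR_ge0.
apply: (@le_trans _ _ (\int[mu]_x \int[mu]_y H (x, y))%E).
  rewrite integral_mkcond; apply: ge0_le_integral => //.
  - by move=> x _; apply: erestrict_ge0 => y _; rewrite lee_fin sqr_ge0.
  - apply: (measurable_restrictT _ mD).1.
    by apply/measurable_EFinP; exact: measurable_funX.
  - exact: (measurable_fun_fubini_tonelli_F (m2 := mu) H mH).
  - move=> x _; rewrite patchE; case: ifPn => [|_]; last by apply: integral_ge0 => y _.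
    rewrite inE RposE => x0.
    apply: le_trans (hilbert_kernel_sqr_le a0 b0 x0 mv v0 (F0 x x0) (FK x x0)) _.
    rewrite -/c -ge0_integralZl_EFin//; last 3 first.
    + move=> y _; rewrite lee_fin; apply: mulr_ge0; first exact: hilbert_kernel_ge0.
      by apply: mulr_ge0; [exact: powR_ge0|exact: sqr_ge0].
    + apply/measurable_EFinP; apply: measurable_funM; first exact: measurable_hilbert_kernel.
      by apply: measurable_funM; [exact: measurable_powR_Rpos|exact: measurable_funX].
    + by rewrite mulr_ge0 ?powR_ge0// ltW.
    rewrite integral_mkcond le_eqVlt; apply/orP; left; apply/eqP.
    apply: eq_integral => y _; rewrite /H /g /h /= !patchE.
    rewrite (_ : x \in _); last by rewrite inE RposE.
    case: ifPn => [|_]; last by rewrite mulr0 mul0r.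
    rewrite inE RposE => y0; rewrite -EFinM; congr EFin.
    rewrite /hilbert_kernel (gt0_powRD a (- 2^-1) x0) (gt0_powRD b 2^-1 y0); ring.
rewrite (fubini_tonelli (m1 := mu) (m2 := mu) H mH H0).
rewrite -ge0_integralZl_EFin ?sqr_ge0//; last 2 first.
- by move=> y _; rewrite lee_fin sqr_ge0.
- by apply/measurable_EFinP; exact: measurable_funX.
rewrite [leRHS]integral_mkcond; apply: ge0_le_integral => //.
- by move=> y _; apply: integral_ge0 => x _.
- exact: (measurable_fun_fubini_tonelli_G (m1 := mu) H mH).
- apply: (measurable_restrictT _ mD).1.
  by apply: measurable_funeM; apply/measurable_EFinP; exact: measurable_funX.
- move=> y _; rewrite patchE; case: ifPn => [|yN]; last first.
    rewrite le_eqVlt; apply/orP; left; apply/eqP; apply: integral0_eq => x _.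
    by rewrite /H /h /= patchE (negbTE yN) mulr0 mul0r.
  rewrite inE RposE => y0.
  pose d := c * (y `^ (b + 2^-1) * v y ^+ 2).
  have d0 : 0 <= d.
    apply: mulr_ge0; first exact: ltW.
    by apply: mulr_ge0; [exact: powR_ge0|exact: sqr_ge0].
  have mk : measurable_fun (@Rpos R)
      (fun x => (hilbert_kernel b a y x * x `^ (- 2^-1))%:E).
    apply/measurable_EFinP; apply: measurable_funM; last exact: measurable_powR_Rpos.
    exact: measurable_hilbert_kernel.
  (* In the variable [x] this is the transposed kernel against the same weight; [y^(-b)] cancels the
     power [y^b] which that kernel brings. *)
  have -> : (\int[mu]_x H (x, y) = (d * y `^ (- b))%:E *
      \int[mu]_(x in @Rpos R) (hilbert_kernel b a y x * x `^ (- 2^-1))%:E)%E.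
    rewrite -ge0_integralZl_EFin//; last 2 first.
    + by move=> x _; rewrite lee_fin mulr_ge0 ?hilbert_kernel_ge0 ?powR_ge0.
    + by rewrite mulr_ge0 ?powR_ge0.
    rewrite [RHS]integral_mkcond; apply: eq_integral => x _.
    rewrite /H /g /h /= !patchE (_ : y \in _); last by rewrite inE RposE.
    case: ifPn => [|_]; last by rewrite !mul0r.
    rewrite inE RposE => x0; rewrite -EFinM; congr EFin.
    rewrite /hilbert_kernel (gt0_powRD a (- 2^-1) x0) /d [y + x]addrC.
    have -> : - b - a - 1 = - a - b - 1 by ring.
    have : y `^ (- b) * y `^ b = 1 by rewrite -gt0_powRD// addNr powRr0.
    move: (y `^ (- b)) (y `^ b) => p q pq; rewrite -[LHS]mulr1 -pq; ring.
  apply: le_trans (lee_wpmul2l _ (hilbert_kernel_test b0 a0 y0)) _.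
    by rewrite lee_fin mulr_ge0 ?powR_ge0.
  rewrite -!EFinM lee_fin (_ : hilbert_const b a = c); last first.
    by rewrite /c /hilbert_const [(b + _)^-1 + _]addrC.
  rewrite le_eqVlt; apply/orP; left; apply/eqP.
  rewrite /d (gt0_powRD b 2^-1 y0).
  have : y `^ b * y `^ (- b) = 1 by rewrite -gt0_powRD// subrr powRr0.
  have : y `^ 2^-1 * y `^ (- 2^-1) = 1 by rewrite -gt0_powRD// subrr powRr0.
  move: (y `^ (- b)) (y `^ b) (y `^ 2^-1) (y `^ (- 2^-1)) => p q p' q' h1 h2.
  rewrite -[RHS]mulr1 -h1 -[RHS]mulr1 -h2; ring.
Qed.

End hilbert_kernel.

(** * Symbols *)

Section symbols.
Variable R : realType.
Implicit Types (I J : set R) (k : nat) (m a t : R) (f g : R -> R).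

(* Symbols of order [m] in the sense of pseudodifferential calculus, up to [k]
   derivatives: [D^j f = O(t^(m - j))] on [I] for all [j <= k]. *)
Fixpoint symbol I k m f : Prop :=
  (exists C, forall t, I t -> `|f t| <= C * t `^ m) /\
  if k is k'.+1 then
    (forall t, I t -> derivable f t 1) /\ symbol I k' (m - 1) (derive1 f)
  else True.

Lemma symbol_bound I k m f : symbol I k m f ->
  exists C, 0 <= C /\ forall t, I t -> `|f t| <= C * t `^ m.
Proof.
have h : (exists C, forall t, I t -> `|f t| <= C * t `^ m) ->
  exists C, 0 <= C /\ forall t, I t -> `|f t| <= C * t `^ m.
  move=> [C fC]; exists `|C|; split => // t It.
  by rewrite (le_trans (fC _ It))// ler_wpM2r ?powR_ge0// ler_norm.
by case: k => [|k] [/h].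
Qed.

Lemma symbolW I k m f : symbol I k.+1 m f -> symbol I k m f.
Proof.
elim: k m f => [|k IHk] m f; first by move=> [].
by move=> [fC [df sf]]; split => //; split => //; exact: IHk.
Qed.

Lemma symbolU I J k m f : symbol I k m f -> symbol J k m f ->
  symbol (I `|` J) k m f.
Proof.
elim: k m f => [|k IHk] m f sI sJ.
  split => //; move: (symbol_bound sI) (symbol_bound sJ).
  move=> [C [C0 fC]] [D [D0 fD]]; exists (C + D) => t [It|Jt].
    by rewrite (le_trans (fC _ It))// ler_wpM2r ?powR_ge0// lerDl.
  by rewrite (le_trans (fD _ Jt))// ler_wpM2r ?powR_ge0// lerDr.
move: (symbol_bound sI) (symbol_bound sJ) => [C [C0 fC]] [D [D0 fD]].
move: sI sJ => [_ [dI sI]] [_ [dJ sJ]]; split.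
  exists (C + D) => t [It|Jt].
    by rewrite (le_trans (fC _ It))// ler_wpM2r ?powR_ge0// lerDl.
  by rewrite (le_trans (fD _ Jt))// ler_wpM2r ?powR_ge0// lerDr.
by split; [move=> t [/dI|/dJ]|exact: IHk].
Qed.

Lemma symbol_derive1n I k m f : symbol I k m f -> forall j, (j <= k)%N ->
  exists C, 0 <= C /\ forall t, I t -> `|derive1n j f t| <= C * t `^ (m - j%:R).
Proof.
elim: k m f => [|k IHk] m f sf [|j]// jk; rewrite ?mulr0n ?subr0.
- exact: symbol_bound sf.
- exact: symbol_bound sf.
- case: sf => [_ [_ /IHk /(_ j jk) [C [C0 fC]]]]; exists C; split => // t It.
  have -> : m - j.+1%:R = m - 1 - j%:R by rewrite -natr1; ring.
  by rewrite /derive1n iterSr; exact: fC.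
Qed.

Lemma symbol_derivable I k m f : symbol I k m f -> forall j, (j < k)%N ->
  forall t, I t -> derivable (derive1n j f) t 1.
Proof.
elim: k m f => [|k IHk] m f sf [|j]// jk t It; first by case: sf => [_ [/(_ t It)]].
case: sf => [_ [_ /IHk /(_ j jk t It)]].
by rewrite /derive1n iterSr.
Qed.

(** * Symbol calculus on an open subset of the half-line *)

Section on_open_set.
Variable I : set R.
Hypotheses (oI : open I) (I_gt0 : forall t, I t -> 0 < t).

(** Openness of [I] turns equality on [I] into equality near each of its points, hence into equality
    of derivatives. *)
Lemma eq_symbol k m f g : (forall t, I t -> f t = g t) ->
  symbol I k m f -> symbol I k m g.
Proof.
have near_eq (h1 h2 : R -> R) t : (forall t, I t -> h1 t = h2 t) -> I t -> {near t, h1 =1 h2}.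
  move=> e It; near=> s; apply: e; near: s; exact: open_nbhs_nbhs.
elim: k m f g => [|k IHk] m f g fg.
  by move=> [[C fC] _]; split => //; exists C => t It; rewrite -fg// fC.
move=> [[C fC] [df sf]]; split; first by exists C => t It; rewrite -fg// fC.
split=> [t It|]; first by refine (near_eq_derivable (near_eq f g t fg It) (df t It)).
apply: IHk sf => t It; rewrite !derive1E; apply: near_eq_derive.
exact: near_eq.
Unshelve. all: by end_near. Qed.

(** Dividing the comparison of the two powers by [t] gives the same comparison, with the same [K],
    for the orders of the derivative. *)
Lemma symbol_order k m m' f : (exists K, forall t, I t -> t `^ m <= K * t `^ m') ->
  symbol I k m f -> symbol I k m' f.
Proof.
elim: k m m' f => [|k IHk] m m' f [K mK] sf;
    have [C [C0 fC]] := symbol_bound sf.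
  split => //; exists (C * K) => t It.
  by rewrite (le_trans (fC t It))// -mulrA ler_wpM2l// mK.
split; first by exists (C * K) => t It; rewrite (le_trans (fC t It))// -mulrA ler_wpM2l// mK.
move: sf => [_ [df sf]]; split => //; apply: IHk sf; exists K => t It.
have t0 := I_gt0 It; rewrite -(ler_pM2r t0) -mulrA !powR_subr1//.
exact: mK.
Qed.

Lemma symbol0 k m : symbol I k m (fun=> 0).
Proof.
elim: k m => [|k IHk] m.
  by split => //; exists 0 => t _; rewrite normr0 mul0r.
split; first by exists 0 => t _; rewrite normr0 mul0r.
split=> [t _|]; first exact: derivable_cst.
by apply: eq_symbol (IHk _) => t _; rewrite derive1_cst.
Qed.

Lemma symbolD k m f g : symbol I k m f -> symbol I k m g ->
  symbol I k m (fun t => f t + g t).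
Proof.
elim: k m f g => [|k IHk] m f g sf sg;
    have [C [C0 fC]] := symbol_bound sf; have [D [D0 gD]] := symbol_bound sg.
  split => //; exists (C + D) => t It.
  by rewrite (le_trans (ler_normD _ _))// mulrDl lerD ?fC ?gD.
move: sf sg => [_ [df sf]] [_ [dg sg]]; split.
  exists (C + D) => t It.
  by rewrite (le_trans (ler_normD _ _))// mulrDl lerD ?fC ?gD.
split=> [t It|]; first exact: derivableD (df t It) (dg t It).
apply: eq_symbol (IHk _ _ _ sf sg) => t It.
by rewrite !derive1E deriveD; [|exact: df|exact: dg].
Qed.

Lemma symbolM k m m' f g : symbol I k m f -> symbol I k m' g ->
  symbol I k (m + m') (fun t => f t * g t).
Proof.
elim: k m m' f g => [|k IHk] m m' f g sf sg;
    have [C [C0 fC]] := symbol_bound sf; have [D [D0 gD]] := symbol_bound sg.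
  split => //; exists (C * D) => t It.
  by rewrite normrM gt0_powRD ?I_gt0// mulrACA ler_pM ?fC ?gD.
split.
  exists (C * D) => t It.
  by rewrite normrM gt0_powRD ?I_gt0// mulrACA ler_pM ?fC ?gD.
have sf' := symbolW sf; have sg' := symbolW sg.
move: sf sg => [_ [df sf]] [_ [dg sg]].
split=> [t It|]; first exact: derivableM (df t It) (dg t It).
(* The two Leibniz terms have the same order, but the induction hypothesis yields it in two forms,
   [m + (m' - 1)] and [m' + (m - 1)]. *)
have := symbolD (k := k) (m := m + m' - 1) (f := fun t => f t * derive1 g t)
  (g := fun t => g t * derive1 f t).
have -> : m + m' - 1 = m + (m' - 1) by ring.
move=> /(_ (IHk _ _ _ _ sf' sg)).
have {1}-> : m + (m' - 1) = m' + (m - 1) by ring.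
move=> /(_ (IHk _ _ _ _ sg' sf)).
apply: eq_symbol => t It.
by rewrite !derive1E deriveM; [|exact: df|exact: dg].
Qed.

Lemma symbol_cst k c : symbol I k 0 (fun=> c).
Proof.
case: k => [|k].
  by split => //; exists `|c| => t _; rewrite powRr0 mulr1.
split; first by exists `|c| => t _; rewrite powRr0 mulr1.
split=> [t _|]; first exact: derivable_cst.
by apply: eq_symbol (symbol0 k _) => t _; rewrite derive1_cst.
Qed.

Lemma symbolZ k m c f : symbol I k m f -> symbol I k m (fun t => c * f t).
Proof. by move=> sf; have := symbolM (symbol_cst k c) sf; rewrite add0r. Qed.

Lemma symbol_powR k m : symbol I k m (fun t => t `^ m).
Proof.
elim: k m => [|k IHk] m.
  by split => //; exists 1 => t _; rewrite mul1r ger0_norm ?powR_ge0.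
split; first by exists 1 => t _; rewrite mul1r ger0_norm ?powR_ge0.
split=> [t /I_gt0 t0|]; first by have [] := is_derive1_powR m t0.
apply: eq_symbol (symbolZ m (IHk (m - 1))) => t /I_gt0 t0.
by rewrite derive1E; have [_ ->] := is_derive1_powR m t0.
Qed.

Lemma symbol_id k : symbol I k 1 id.
Proof.
by apply: eq_symbol (symbol_powR k 1) => t /I_gt0 t0; rewrite powRr1 ?ltW.
Qed.

Lemma is_derive_comp_powR a f t : derivable f t 1 -> 0 < f t ->
  is_derive t 1 (fun s => f s `^ a) (a * f t `^ (a - 1) * derive1 f t).
Proof.
move=> df ft; have := is_derive1_powR a ft => dp.
have dft : is_derive t 1 f (derive1 f t) by rewrite derive1E; exact/derivableP.
exact: (is_derive1_comp (f := fun s => s `^ a)).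
Qed.

(** Values in [[1, D]] keep every real power of [f] bounded, whatever its sign. The induction must
    range over [a], since differentiating lowers the exponent. *)
Lemma symbol_comp_powR k a D f : (forall t, I t -> 1 <= f t <= D) ->
  symbol I k 0 f -> symbol I k 0 (fun t => f t `^ a).
Proof.
move=> fD; have b b' : exists C, forall t, I t -> `|f t `^ b'| <= C * t `^ 0.
  exists (Num.max 1 (D `^ b')) => t It.
  rewrite powRr0 mulr1 ger0_norm ?powR_ge0// le_max.
  have /andP[f1 ftD] := fD t It.
  have [b0|b0] := leP 0 b'.
    apply/orP; right; rewrite ge0_ler_powR ?nnegrE//.
      by rewrite (le_trans ler01).
    by rewrite (le_trans ler01)// (le_trans f1).
  apply/orP; left; rewrite -[leRHS](powRr0 (f t)).
  by rewrite ler_powR// ltW.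
elim: k a => [|k IHk] a sf; first by split.
split => //; have sf' := symbolW sf.
have ft0 t : I t -> 0 < f t by move=> /fD /andP[+ _]; exact: lt_le_trans.
move: sf => [_ [df sf]]; split=> [t It|].
  by have [] := is_derive_comp_powR a (df t It) (ft0 t It).
have := symbolM (symbolZ a (IHk (a - 1) sf')) sf; rewrite add0r.
apply: eq_symbol => t It; rewrite [RHS]derive1E.
by have [_ ->] := is_derive_comp_powR a (df t It) (ft0 t It).
Qed.

Lemma powR_sub1_le a (D x : R) : 1 <= a -> 1 <= x <= D ->
  `|x `^ a - 1| <= a * D `^ (a - 1) * `|x - 1|.
Proof.
move=> a1 /andP[]; rewrite le_eqVlt => /predU1P[<- _|x1 xD].
  by rewrite powR1 !subrr normr0 mulr0.
have dp (y : R) : y \in `]1, x[ -> is_derive y 1 (fun z => z `^ a) (a * y `^ (a - 1)).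
  by rewrite in_itv /= => /andP[y1 _]; apply: is_derive1_powR; rewrite (lt_trans _ y1).
have [|c] := MVT x1 dp.
  apply: derivable_within_continuous => y; rewrite in_itv /= => /andP[y1 _].
  by have [] := is_derive1_powR a (lt_le_trans ltr01 y1).
rewrite in_itv /= powR1 => /andP[c1 cx] ->.
rewrite normrM ler_wpM2r// ger0_norm.
  rewrite ler_wpM2l ?(le_trans ler01)// ge0_ler_powR ?subr_ge0// ?nnegrE.
  - by rewrite (le_trans ler01)// ltW.
  - by rewrite (le_trans ler01)// (le_trans _ xD)// ltW.
  - by rewrite (le_trans (ltW cx)).
by rewrite mulr_ge0 ?powR_ge0// (le_trans ler01).
Qed.

(** The smallness of [f - 1] passes to [f^a - 1] by the mean value theorem. The derivative
    [a * f^(a-1) * f'] needs no further induction: its first factor has order 0, and [f'] has order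
    [m - 1] because it is also the derivative of [f - 1]. *)
Lemma symbol_comp_powRB1 k m a D f : 1 <= a -> (forall t, I t -> 1 <= f t <= D) ->
  symbol I k 0 f -> symbol I k m (fun t => f t - 1) ->
  symbol I k m (fun t => f t `^ a - 1).
Proof.
move=> a1 fD sf sf1; have [C [C0 fC]] := symbol_bound sf1.
have b0 : exists C, forall t, I t -> `|f t `^ a - 1| <= C * t `^ m.
  exists (a * D `^ (a - 1) * C) => t It.
  rewrite (le_trans (powR_sub1_le a1 (fD t It)))// -[leRHS]mulrA ler_wpM2l ?fC//.
  by rewrite mulr_ge0 ?powR_ge0// (le_trans ler01).
case: k => [|k] in sf sf1 *; first by split.
split => //.
have ft0 t : I t -> 0 < f t by move=> /fD /andP[+ _]; exact: lt_le_trans.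
have sf' := symbolW sf; move: sf sf1 => [_ [df sf]] [_ [df1 sf1]].
have dp t It := is_derive_comp_powR a (df t It) (ft0 t It).
split=> [t It|]; first by apply: derivableB => //; have [] := dp t It.
have := symbolM (symbolZ a (symbol_comp_powR (a - 1) fD sf')) sf1; rewrite add0r.
apply: eq_symbol => t It; rewrite !derive1E !deriveB//.
- by rewrite !derive_cst !subr0; have [_ ->] := dp t It; rewrite derive1E.
- by have [] := dp t It.
- exact: df.
Qed.

End on_open_set.
End symbols.

(** * Laplace transforms of bounded densities *)

Section laplace.
Variable R : realType.
Implicit Types (m : R -> R) (k j n : nat) (a c s t y mo : R) (I : set R).
Notation mu := (@lebesgue_measure R).

Lemma is_derive_expRMl s y : is_derive y 1 (fun z : R => expR (- (s * z)))
  (- s * expR (- (s * y))).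
Proof.
have d : is_derive y (1 : R) (fun z : R => - (s * z)) (- s).
  apply: is_derive_eq (is_deriveN (is_deriveZ s (is_derive_id y 1))) _.
  by rewrite /GRing.scale /= mulr1.
have := is_derive1_comp (g := fun z => - (s * z)) (is_derive_expR (- (s * y))) d.
by rewrite mulrC.
Qed.

Lemma integral_expR_itvcy a s : 0 < s ->
  (\int[mu]_(y in `[a, +oo[) (expR (- (s * y)))%:E = (expR (- (s * a)) / s)%:E)%E.
Proof.
move=> s0; pose F y := - s^-1 * expR (- (s * y)).
have dF y : is_derive y 1 F (expR (- (s * y))).
  apply: is_derive_eq (is_deriveZ (- s^-1) (is_derive_expRMl s y)) _.
  by rewrite /GRing.scale /= mulNr mulrA mulrN mulVf ?gt_eqF// mulN1r opprK.
have cF y : {for y, continuous F}.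
  by apply/differentiable_continuous/derivable1_diffP; have [] := dF y.
rewrite (@ge0_continuous_FTC2y _ _ F _ 0).
- by rewrite /F add0e -EFinN mulNr opprK mulrC.
- by move=> y _; exact: expR_ge0.
- apply: continuous_subspaceT => y.
  apply/differentiable_continuous/derivable1_diffP.
  by have [] := is_derive_expRMl s y.
- rewrite -(mulr0 (- s^-1)); apply: cvgM; first exact: cvg_cst.
  apply: (@cvg_comp _ _ _ (fun y => s * y) (fun z => expR (- z))); last exact: cvgr_expR.
  exact: gt0_cvgMry.
- by move=> y _; have [] := dF y.
- exact/cvg_at_right_filter/cF.
- by move=> y _; have [_] := dF y; rewrite derive1E.
Qed.

Lemma integral_expR_Rpos s : 0 < s ->
  (\int[mu]_(y in @Rpos R) (expR (- (s * y)))%:E = (s^-1)%:E)%E.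
Proof.
move=> s0; rewrite /Rpos integral_itv_obnd_cbnd; last first.
  apply/measurable_EFinP; apply: measurable_fun_Rpos => y _.
  by have [] := is_derive_expRMl s y.
by rewrite integral_expR_itvcy// mulr0 oppr0 expR0 mul1r.
Qed.

Lemma integrable_expR_Rpos s : 0 < s ->
  mu.-integrable (@Rpos R) (fun y => (expR (- (s * y)))%:E).
Proof.
move=> s0; apply/integrableP; split.
  apply/measurable_EFinP; apply: measurable_fun_Rpos => y _.
  by have [] := is_derive_expRMl s y.
under eq_integral do rewrite /= ger0_norm ?expR_ge0//.
by rewrite integral_expR_Rpos// ltry.
Qed.

Lemma exprn_le_expR n s : 0 <= s -> s ^+ n <= n`!%:R * expR s.
Proof.
case: n => [|n] s0; first by rewrite expr0 fact0 mul1r -expR0 ler_expR.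
have := expR_ge1Dxn n s0; rewrite -ler_pdivrMl ?ltr0n ?fact_gt0// mulrC.
by apply: le_trans; rewrite lerDr.
Qed.

(** Half of the exponential is spent on absorbing [y^n]; the other half remains integrable. *)
Lemma exprn_expR_le n s y : 0 < s -> 0 < y ->
  y ^+ n * expR (- (s * y)) <= n`!%:R * (2 / s) ^+ n * expR (- (s / 2 * y)).
Proof.
move=> s0 y0; have sy : 0 <= s / 2 * y by rewrite !mulr_ge0 ?invr_ge0 ?(ltW s0) ?(ltW y0).
have := exprn_le_expR n sy.
have -> : - (s * y) = - (s / 2 * y) - s / 2 * y by lra.
rewrite expRD mulrA ler_pM2r ?expR_gt0// expRN ler_pdivrMr ?expR_gt0//.
have -> : y ^+ n = (2 / s) ^+ n * (s / 2 * y) ^+ n.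
  by rewrite -exprMn; congr (_ ^+ n); field; rewrite gt_eqF.
move=> h; rewrite [n`!%:R * (2 / s) ^+ n]mulrC -[leRHS]mulrA.
by rewrite ler_wpM2l// exprn_ge0// divr_ge0 ?(ltW s0).
Qed.

Lemma measurable_exprn_expR n s :
  measurable_fun (@Rpos R) (fun y => y ^+ n * expR (- (s * y))).
Proof.
apply: measurable_funM; first exact: measurable_funX.
apply: measurable_fun_Rpos => y _; by have [] := is_derive_expRMl s y.
Qed.

Lemma integrable_exprn_expR n s : 0 < s ->
  mu.-integrable (@Rpos R) (fun y => (y ^+ n * expR (- (s * y)))%:E).
Proof.
move=> s0; have s20 : 0 < s / 2 by rewrite divr_gt0.
apply: (le_integrable measurable_Rpos _ _
  (integrableZl measurable_Rpos (n`!%:R * (2 / s) ^+ n) (integrable_expR_Rpos s20))).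
- apply/measurable_EFinP; exact: measurable_exprn_expR.
- move=> y; rewrite RposE => y0; rewrite /= lee_fin ger0_norm.
    exact: le_trans (exprn_expR_le n s0 y0) (ler_norm _).
  by rewrite mulr_ge0 ?expR_ge0// exprn_ge0// ltW.
Qed.

Lemma Rintegral_exprn_expR_le n s : 0 < s ->
  \int[mu]_(y in @Rpos R) (y ^+ n * expR (- (s * y))) <=
  n`!%:R * (2 / s) ^+ n.+1.
Proof.
move=> s0; have s20 : 0 < s / 2 by rewrite divr_gt0.
have ie := integrable_expR_Rpos s20.
apply: le_trans (le_Rintegral measurable_Rpos (integrable_exprn_expR n s0)
  (integrableZl measurable_Rpos (n`!%:R * (2 / s) ^+ n) ie) _) _.
  by move=> y; rewrite RposE => y0; exact: exprn_expR_le.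
rewrite RintegralZl//; last exact: measurable_Rpos.
by rewrite /Rintegral integral_expR_Rpos//= invf_div exprSr mulrA.
Qed.

(** For bounded [m] and [t > 0], this is the [k]-th derivative of the Laplace transform of [m],
    whence the factor [(- y)^k]. *)
Definition laplace m k t : R :=
  \int[mu]_(y in @Rpos R) (m y * (- y) ^+ k * expR (- (t * y))).

Section bounded_density.
Variable m : R -> R.
Hypotheses (mm : measurable_fun (@Rpos R) m) (m1 : forall y, 0 < y -> `|m y| <= 1).

Lemma laplace_integrand_le k t y : 0 < y ->
  `|m y * (- y) ^+ k * expR (- (t * y))| <= y ^+ k * expR (- (t * y)).
Proof.
move=> y0; rewrite !normrM normrX normrN (gtr0_norm y0) (ger0_norm (expR_ge0 _)).
by rewrite ler_wpM2r ?expR_ge0// ler_piMl ?m1// exprn_ge0// ltW.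
Qed.

Lemma integrable_laplace k t : 0 < t ->
  mu.-integrable (@Rpos R) (fun y => (m y * (- y) ^+ k * expR (- (t * y)))%:E).
Proof.
move=> t0; apply: (le_integrable measurable_Rpos _ _ (integrable_exprn_expR k t0)).
- apply/measurable_EFinP; apply: measurable_funM.
    by apply: measurable_funM => //; apply: measurable_funX; apply: measurable_funN; exact: measurable_id.
  by apply: measurable_fun_Rpos => y _; have [] := is_derive_expRMl t y.
- move=> y; rewrite RposE => y0; rewrite lee_fin.
  exact: le_trans (laplace_integrand_le k t y0) (ler_norm _).
Qed.

Lemma is_derive_laplace k t : 0 < t ->
  is_derive t 1 (laplace m k) (laplace m k.+1 t).
Proof.
move=> t0; pose f s y : R := m y * (- y) ^+ k * expR (- (s * y)).
(* For [s > t / 2] the differentiated integrand is dominated by its majorant at [t / 2]. *)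
pose G y : R := `|y ^+ k.+1 * expR (- (t / 2 * y))|.
have df s y : is_derive s 1 (f ^~ y) (m y * (- y) ^+ k.+1 * expR (- (s * y))).
  have := is_deriveZ (m y * (- y) ^+ k) (is_derive_expRMl y s).
  rewrite /f; under eq_fun do rewrite [y * _]mulrC.
  by move=> /is_derive_eq; apply; rewrite /GRing.scale /= exprSr [y * s]mulrC; ring.
have d1 s y : partial1of2 f s y = m y * (- y) ^+ k.+1 * expR (- (s * y)).
  by rewrite partial1of2E; have [_ ->] := df s y.
have tI : `]t / 2, t + 1[%classic t.
  by rewrite /= in_itv /=; apply/andP; split; lra.
have t2 : 0 < t / 2 by rewrite divr_gt0.
have fi s : `]t / 2, t + 1[%classic s -> mu.-integrable (@Rpos R) (EFin \o f s).
  rewrite /= in_itv /= => /andP[ts _]; apply: integrable_laplace.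
  exact: lt_trans ts.
have fd s y : `]t / 2, t + 1[%classic s -> @Rpos R y -> derivable (f ^~ y) s 1.
  by move=> _ _; have [] := df s y.
have G0 y : 0 <= G y by exact: normr_ge0.
have iG : mu.-integrable (@Rpos R) (EFin \o G).
  apply: eq_integrable (integrable_exprn_expR k.+1 t2); first exact: measurable_Rpos.
  move=> y; rewrite inE RposE => y0; rewrite /G /= ger0_norm// mulr_ge0 ?expR_ge0//.
  by rewrite exprn_ge0// ltW.
have fG s y : `]t / 2, t + 1[%classic s -> @Rpos R y -> `|partial1of2 f s y| <= G y.
  rewrite RposE /= in_itv /= => /andP[ts _] y0; rewrite d1.
  apply: le_trans (laplace_integrand_le k.+1 s y0) _.
  apply: le_trans (ler_norm _).
  by rewrite ler_wpM2l ?exprn_ge0 ?(ltW y0)// ler_expR lerN2 ler_pM2r// ltW.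
split; first exact: (derivable_under_integral measurable_Rpos tI fi fd G0 iG fG).
have := differentiation_under_integral measurable_Rpos tI fi fd G0 iG fG.
rewrite derive1E => ->; rewrite /laplace; apply: eq_Rintegral => y _.
exact: d1.
Qed.

(** The freedom in [j] and [s] serves the two regimes. Near 0, the decay of the density fixes
    [s = 1] independently of [t]; at infinity, the vanishing of the density for small [y] allows
    [j > k], and each extra power of [y] gains a factor [1 / t]. *)
Lemma norm_laplace_le k j t s c : 0 < t -> 0 < s ->
  (forall y, 0 < y ->
    `|m y| * (y ^+ k * expR (- (t * y))) <= c * (y ^+ j * expR (- (s * y)))) ->
  0 <= c -> `|laplace m k t| <= c * (j`!%:R * (2 / s) ^+ j.+1).
Proof.
move=> t0 s0 h c0; have il := integrable_laplace k t0.
apply: le_trans (le_normr_Rintegral measurable_Rpos il) _.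
have ij := integrable_exprn_expR j s0.
apply: (@le_trans _ _ (\int[mu]_(y in @Rpos R) (c * (y ^+ j * expR (- (s * y)))))).
  apply: le_Rintegral; first exact: measurable_Rpos.
  - exact: integrable_norm.
  - exact: (integrableZl measurable_Rpos c ij).
  - move=> y; rewrite RposE => y0.
    rewrite !normrM normrX normrN (gtr0_norm y0) (ger0_norm (expR_ge0 _)) -mulrA.
    exact: h.
rewrite RintegralZl//; last exact: measurable_Rpos.
by rewrite ler_wpM2l// Rintegral_exprn_expR_le.
Qed.

Lemma symbol_laplace I n k mo : open I -> (forall t, I t -> 0 < t) ->
  (forall k, exists C, forall t, I t -> `|laplace m k t| <= C * t `^ (mo - k%:R)) ->
  symbol I n (mo - k%:R) (laplace m k).
Proof.
move=> oI I0 mB; elim: n k => [|n IHn] k; first by split.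
split; first exact: mB.
split=> [t /I0 t0|]; first by have [] := is_derive_laplace k t0.
have -> : mo - k%:R - 1 = mo - k.+1%:R by rewrite -natr1; ring.
apply: eq_symbol (IHn k.+1) => // t /I0 t0.
by rewrite derive1E; have [_ ->] := is_derive_laplace k t0.
Qed.

End bounded_density.
End laplace.

(** * The zeta function as a Laplace transform *)

Section zeta_symbols.
Variable R : realType.
Implicit Types (s t y alpha : R) (k n N : nat).
Notation mu := (@lebesgue_measure R).

Definition floorexp y : R := (Num.trunc (expR y))%:R.

Lemma floorexp_le y : floorexp y <= expR y.
Proof. by have /andP[] := truncn_itv (expR_ge0 y). Qed.

Lemma measurable_floorexp N :
  measurable_fun (@Rpos R) (fun y => (minn N (Num.trunc (expR y)))%:R : R).
Proof.
apply: nondecreasing_measurable; first exact: measurable_Rpos.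
move=> x y xy; rewrite ler_nat leq_min geq_minl /=.
apply: leq_trans (geq_minr _ _) _.
rewrite truncn_ge_nat ?expR_ge0//; apply: le_trans (floorexp_le x) _.
by rewrite ler_expR.
Qed.

(** [floor(e^y)] counts the integers [n >= 1] with [ln n <= y], and [n^(-s)] is [s] times the
    integral of [e^(-s y)] over [[ln n, +oo[]. Capping the count at [N] thus gives exactly the
    [N]-th partial sum; each induction step adds one such half-line. *)
Lemma integral_minn_floorexp N s : 0 < s ->
  (\int[mu]_(y in @Rpos R)
     ((minn N (Num.trunc (expR y)))%:R * expR (- (s * y)))%:E =
   (s^-1 * \sum_(0 <= n < N) n.+1%:R `^ (- s))%:E)%E.
Proof.
move=> s0.
have me : measurable_fun (@Rpos R) (fun y => expR (- (s * y))).
  by apply: measurable_fun_Rpos => y _; have [] := is_derive_expRMl s y.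
elim: N => [|N IHN].
  rewrite big_geq// mulr0; apply: integral0_eq => y _.
  by rewrite min0n mul0r.
pose A : set R := [set` `[ln N.+1%:R : R, +oo[].
have mA : measurable (A : set (measurableTypeR R)) by exact: measurable_itv.
pose e y := (expR (- (s * y)))%:E.
have mrest : measurable_fun (@Rpos R) (e \_ A).
  apply/measurable_restrict => //; first exact: measurable_Rpos.
  apply: (@measurable_funS _ _ _ _ (@Rpos R)); first exact: measurable_Rpos.
    by move=> y [].
  exact/measurable_EFinP.
rewrite (@eq_integral _ _ _ mu _ (fun y =>
    ((minn N (Num.trunc (expR y)))%:R * expR (- (s * y)))%:E + (e \_ A) y)%E); last first.
  move=> y; rewrite inE RposE => y0; rewrite patchE.
  have -> : (y \in A) = (N < Num.trunc (expR y))%N.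
    rewrite truncn_gt_nat -[X in _ = (X <= _)]lnK ?posrE ?ltr0n// ler_expR.
    by apply/idP/idP; rewrite inE /A /= in_itv /= andbT.
  case: ifPn => [NK|]; last rewrite -leqNgt => KN.
    by rewrite !(minn_idPl _) ?(ltnW NK)// -EFinD -natr1 mulrDl mul1r.
  by rewrite adde0 (minn_idPr KN) (minn_idPr (leqW KN)).
rewrite ge0_integralD//=.
- rewrite IHN big_nat_recr//= mulrDr EFinD; congr (_ + _)%E.
  rewrite /Rpos integral_itv_obnd_cbnd// -integral_mkcondr.
  rewrite [X in integral _ X _](_ : _ = A); last first.
    apply/setIidPr => z; rewrite /A /= !in_itv /= !andbT; apply: le_trans.
    by rewrite ln_ge0// ler1n.
  rewrite integral_expR_itvcy//; congr EFin.
  by rewrite mulrC /powR gt_eqF ?ltr0n// mulNr.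
- exact: measurable_Rpos.
- by apply/measurable_EFinP; apply: measurable_funM; [exact: measurable_floorexp|].
- move=> y _; rewrite patchE; case: ifP => // _.
  by rewrite lee_fin expR_ge0.
Qed.

(** Dominated convergence in the cap [N]: since [floor(e^y) <= e^y], the majorant is [e^(-t y)],
    integrable because [t > 0]. *)
Lemma zeta_integral t : 0 < t ->
  mu.-integrable (@Rpos R) (fun y => (floorexp y * expR (- ((1 + t) * y)))%:E) /\
  zeta (1 + t) =
  (1 + t) * \int[mu]_(y in @Rpos R) (floorexp y * expR (- ((1 + t) * y))).
Proof.
move=> t0; set s := 1 + t; have s0 : 0 < s by rewrite addr_gt0.
pose f N y : \bar R := ((minn N (Num.trunc (expR y)))%:R * expR (- (s * y)))%:E.
pose F y : \bar R := (floorexp y * expR (- (s * y)))%:E.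
have me : measurable_fun (@Rpos R) (fun y => expR (- (s * y))).
  by apply: measurable_fun_Rpos => y _; have [] := is_derive_expRMl s y.
have mf N : measurable_fun (@Rpos R) (f N).
  by apply/measurable_EFinP; apply: measurable_funM; [exact: measurable_floorexp|].
have cf y : @Rpos R y -> f N y @[N --> \oo] --> F y.
  move=> _; apply: cvg_near_cst; exists (Num.trunc (expR y)) => // N /= yN.
  by rewrite /f /F (minn_idPr yN).
have mF : measurable_fun (@Rpos R) F by exact: emeasurable_fun_cvg mf cf.
have fg y N : @Rpos R y -> (`|f N y| <= (expR (- (t * y)))%:E)%E.
  move=> _; rewrite /f lee_fin ger0_norm ?mulr_ge0 ?expR_ge0//.
  have -> : expR (- (t * y)) = expR y * expR (- (s * y)).
    by rewrite -expRD; congr expR; rewrite /s; ring.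
  rewrite ler_wpM2r ?expR_ge0//; apply: le_trans (floorexp_le y).
  by rewrite ler_nat geq_minr.
have aecf : {ae mu, forall y, @Rpos R y -> f ^~ y @ \oo --> F y} by exact: aeW.
have aefg : {ae mu, forall y N, @Rpos R y -> (`|f N y| <= (expR (- (t * y)))%:E)%E}.
  exact: aeW.
have [iF _ cI] := @dominated_convergence _ _ _ mu _ measurable_Rpos f F _ mf mF
  aecf (integrable_expR_Rpos t0) aefg.
split => //; rewrite /zeta.
have cS : (s^-1 * \sum_(0 <= n < N) n.+1%:R `^ (- s)) @[N --> \oo] -->
    \int[mu]_(y in @Rpos R) (floorexp y * expR (- (s * y))).
  have /fine_cvgP[_] : (\int[mu]_(y in @Rpos R) f N y)%E @[N --> \oo] -->
      (\int[mu]_(y in @Rpos R) (floorexp y * expR (- (s * y))))%:E.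
    rewrite /Rintegral fineK; first exact: cI.
    exact: (integrable_fin_num measurable_Rpos iF).
  apply: cvg_trans; apply: near_eq_cvg; apply: nearW => N /=.
  by rewrite integral_minn_floorexp.
apply/cvg_lim => //.
rewrite [X in X @ _ --> _](_ : _ = (fun N =>
    s * (s^-1 * \sum_(0 <= n < N) n.+1%:R `^ (- s)))); last first.
  by apply/funext => N; rewrite mulVKf ?gt_eqF.
by apply: cvgM => //; exact: cvg_cst.
Qed.

(* Densities of the regular parts of [zeta (1 + t)] at 0 ([zeta_frac]) and at
   infinity ([zeta_tail]). *)
Definition frac_density y : R := (expR y - floorexp y) * expR (- y).
Definition tail_density y : R := (floorexp y - 1) * expR (- y).

Lemma measurable_floorexpT : measurable_fun (@Rpos R) floorexp.
Proof.
apply: nondecreasing_measurable; first exact: measurable_Rpos.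
move=> x y xy; rewrite ler_nat truncn_ge_nat ?expR_ge0//.
by apply: le_trans (floorexp_le x) _; rewrite ler_expR.
Qed.

Lemma measurable_frac_density : measurable_fun (@Rpos R) frac_density.
Proof.
apply: measurable_funM; first apply: measurable_funB.
- by apply: measurable_funTS; exact: measurable_expR.
- exact: measurable_floorexpT.
- apply: measurable_fun_Rpos => y _.
  have [] := is_derive_expRMl 1 y.
  by under eq_fun do rewrite mul1r.
Qed.

Lemma measurable_tail_density : measurable_fun (@Rpos R) tail_density.
Proof.
apply: measurable_funM; first apply: measurable_funB.
- exact: measurable_floorexpT.
- exact: measurable_cst.
- apply: measurable_fun_Rpos => y _.
  have [] := is_derive_expRMl 1 y.
  by under eq_fun do rewrite mul1r.
Qed.

Lemma frac_density_itv y : 0 <= frac_density y <= expR (- y).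
Proof.
rewrite /frac_density mulr_ge0 ?expR_ge0 ?subr_ge0 ?floorexp_le//=.
rewrite ler_piMl ?expR_ge0// lerBlDr addrC natr1 ltW//.
exact: truncnS_gt.
Qed.

Lemma tail_density_itv y : 0 < y -> 0 <= tail_density y <= 1.
Proof.
move=> y0; have e1 : 1 <= expR y by rewrite -expR0 ler_expR ltW.
apply/andP; split.
  by rewrite mulr_ge0 ?expR_ge0// subr_ge0 ler1n truncn_gt0.
rewrite /tail_density expRN ler_pdivrMr ?expR_gt0// mul1r.
by rewrite (le_trans _ (floorexp_le y))// gerBl.
Qed.

Lemma tail_density0 y : 0 < y -> y < ln 2 -> tail_density y = 0.
Proof.
move=> y0 y2; have e1 : 1 <= expR y by rewrite -expR0 ler_expR ltW.
have /eqP : Num.trunc (expR y) == 1%N.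
  rewrite eqn_leq truncn_gt0 e1 andbT truncn_le_nat.
  by rewrite -[ltRHS]lnK ?posrE ?ltr0n// ltr_expR.
by rewrite /tail_density /floorexp => ->; rewrite subrr mul0r.
Qed.

Lemma frac_density_le1 y : 0 < y -> `|frac_density y| <= 1.
Proof.
move=> y0; have /andP[d0 de] := frac_density_itv y.
by rewrite ger0_norm// (le_trans de)// -expR0 ler_expR oppr_le0 ltW.
Qed.

Lemma tail_density_le1 y : 0 < y -> `|tail_density y| <= 1.
Proof. by move=> y0; have /andP[d0 d1] := tail_density_itv y0; rewrite ger0_norm. Qed.

(** Putting [e^y] in place of its floor would give [(1 + t) / t]; the transform accounts for the
    fractional part. *)
Lemma zeta_frac t : 0 < t ->
  zeta (1 + t) = t^-1 + 1 - (1 + t) * laplace frac_density 0 t.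
Proof.
move=> t0; have [iF ->] := zeta_integral t0.
have -> : laplace frac_density 0 t =
    t^-1 - \int[mu]_(y in @Rpos R) (floorexp y * expR (- ((1 + t) * y))).
  have <- : \int[mu]_(y in @Rpos R) expR (- (t * y)) = t^-1.
    by rewrite /Rintegral integral_expR_Rpos.
  rewrite -RintegralB//; [|exact: measurable_Rpos|exact: integrable_expR_Rpos].
  apply: eq_Rintegral => y _; rewrite expr0 mulr1 /frac_density -mulrA -expRD.
  rewrite mulrBl -expRD; congr (expR _ - _ * expR _); ring.
by field; rewrite gt_eqF.
Qed.

(** Putting 1 in place of [floor(e^y)] would give [(1 + t) / (1 + t) = 1], the first term of the
    series. *)
Lemma zeta_tail t : 0 < t -> zeta (1 + t) = 1 + (1 + t) * laplace tail_density 0 t.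
Proof.
move=> t0; have [iF ->] := zeta_integral t0.
have s0 : 0 < 1 + t by rewrite addr_gt0.
have -> : laplace tail_density 0 t =
    \int[mu]_(y in @Rpos R) (floorexp y * expR (- ((1 + t) * y))) - (1 + t)^-1.
  have <- : \int[mu]_(y in @Rpos R) expR (- ((1 + t) * y)) = (1 + t)^-1.
    by rewrite /Rintegral integral_expR_Rpos.
  rewrite -RintegralB//; [|exact: measurable_Rpos|exact: integrable_expR_Rpos].
  apply: eq_Rintegral => y _; rewrite expr0 mulr1 /tail_density -mulrA -expRD.
  rewrite mulrBl mul1r; congr (_ * expR _ - expR _); ring.
by field; rewrite gt_eqF.
Qed.

End zeta_symbols.

(** * Symbol estimates for [r] *)

Section r_symbol.
Variable R : realType.
Implicit Types (t y mo alpha : R) (k n : nat).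
Notation mu := (@lebesgue_measure R).

(** The intervals overlap so that both can be open and still cover the half-line. *)
Local Notation I0 := [set t : R | 0 < t < 2].
Local Notation I1 := [set t : R | 1 < t].

Let oI0 : open I0.
Proof.
have -> : I0 = [set` `]0 : R, 2[] by apply/seteqP; split => t; rewrite /= in_itv.
exact: interval_open.
Qed.

Let oI1 : open I1.
Proof. exact: open_gt. Qed.

Let I0_gt0 t : I0 t -> 0 < t. Proof. by case/andP. Qed.

Let I1_gt0 t : I1 t -> 0 < t. Proof. exact: lt_trans. Qed.

(** The density is at most [e^(-y)], whose transform is [1 / (1 + t)]. The sharp bound 1 is what
    makes [scaled_zeta] at least 1. *)
Lemma laplace_frac_density_itv t : 0 < t ->
  0 <= (1 + t) * laplace (@frac_density R) 0 t <= 1.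
Proof.
move=> t0; have s0 : 0 < 1 + t by rewrite addr_gt0.
apply/andP; split.
  rewrite mulr_ge0 ?(ltW s0)//; apply: Rintegral_ge0 => y _.
  by have /andP[? _] := frac_density_itv y; rewrite expr0 mulr1 mulr_ge0 ?expR_ge0.
rewrite mulrC -ler_pdivlMr// mul1r.
have <- : \int[mu]_(y in @Rpos R) expR (- ((1 + t) * y)) = (1 + t)^-1.
  by rewrite /Rintegral integral_expR_Rpos.
apply: le_Rintegral; first exact: measurable_Rpos.
- apply: integrable_laplace => //; first exact: measurable_frac_density.
  exact: frac_density_le1.
- exact: integrable_expR_Rpos.
- move=> y _; rewrite expr0 mulr1 mulrDl opprD expRD mul1r ler_wpM2r ?expR_ge0//.
  by have /andP[] := frac_density_itv y.
Qed.

Lemma symbol_laplace_frac_density k : symbol I0 k 0 (laplace (@frac_density R) 0).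
Proof.
have := @symbol_laplace _ _ (@measurable_frac_density R) (@frac_density_le1 R) I0 k 0 0.
rewrite subr0; apply => // j.
(* The factor [j! * 2^(j+1)] bounds the integral of [y^j e^(-y)], uniformly in [t]; [2^j] turns this
   into a multiple of [t^(-j)], as [t < 2]. *)
exists (1 * (j`!%:R * (2 / 1) ^+ j.+1) * 2 ^+ j) => t /andP[t0 t2].
apply: (@le_trans _ _ (1 * (j`!%:R * (2 / 1) ^+ j.+1))).
  apply: norm_laplace_le => //.
  - exact: measurable_frac_density.
  - exact: frac_density_le1.
  - move=> y y0; rewrite mul1r mulrCA ler_wpM2l ?exprn_ge0 ?(ltW y0)//.
    have /andP[d0 de] := frac_density_itv y.
    rewrite ger0_norm// mul1r -[leRHS]mulr1 ler_pM ?expR_ge0//.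
    by rewrite -expR0 ler_expR oppr_le0 mulr_ge0 ?(ltW t0) ?(ltW y0).
rewrite -[leRHS]mulrA ler_peMr ?mulr_ge0 ?exprn_ge0//.
rewrite sub0r powR_invn ?(ltW t0)// ler_pdivlMr ?exprn_gt0// mul1r.
by rewrite lerXn2r ?nnegrE ?(ltW t0)// ltW.
Qed.

(** Where the density is nonzero, [1 <= (y / ln 2)^M] for any [M], and powers of [y] become powers
    of [1 / t]. Every order [mo] is therefore available. *)
Lemma symbol_laplace_tail_density k mo :
  symbol I1 k mo (laplace (@tail_density R) 0).
Proof.
have := @symbol_laplace _ _ (@measurable_tail_density R) (@tail_density_le1 R) I1 k 0 mo.
rewrite subr0; apply => // j.
have l2 : 0 < ln (2 : R) by rewrite ln_gt0// ltr1n.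
(* [M > |mo|] makes [- (j + M + 1) <= mo - j], which suffices since [t > 1]. *)
pose M := (Num.trunc `|mo|).+1.
exists ((ln 2) ^- M * ((j + M)`!%:R * 2 ^+ (j + M).+1)) => t t1.
have t0 := I1_gt0 t1.
apply: (@le_trans _ _ ((ln 2) ^- M * ((j + M)`!%:R * (2 / t) ^+ (j + M).+1))).
  apply: norm_laplace_le => //.
  - exact: measurable_tail_density.
  - exact: tail_density_le1.
  - move=> y y0; have [y2|y2] := ltP y (ln 2).
      rewrite tail_density0// normr0 mul0r !mulr_ge0 ?expR_ge0 ?invr_ge0 ?exprn_ge0 ?(ltW y0)//.
      exact: ltW.
    have -> : ln 2 ^- M * (y ^+ (j + M) * expR (- (t * y))) =
        ln 2 ^- M * y ^+ M * (y ^+ j * expR (- (t * y))) by rewrite exprD; ring.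
    rewrite ler_wpM2r ?mulr_ge0 ?expR_ge0 ?exprn_ge0 ?(ltW y0)//.
    apply: le_trans (tail_density_le1 y0) _.
    rewrite mulrC ler_pdivlMr ?exprn_gt0// mul1r.
    by rewrite lerXn2r ?nnegrE ?(ltW l2) ?(ltW y0).
  - by rewrite invr_ge0 exprn_ge0// ltW.
rewrite -!mulrA ler_wpM2l ?invr_ge0 ?exprn_ge0 ?(ltW l2)// ler_wpM2l//.
rewrite expr_div_n ler_wpM2l ?exprn_ge0// -powR_invn ?(ltW t0)// ler_powR ?(ltW t1)//.
have := truncnS_gt `|mo|; rewrite -/M => hM.
have := ler_norm (- mo); rewrite normrN -natr1 natrD => h; lra.
Qed.

Definition scaled_zeta t : R := t * zeta (1 + t).
Local Notation w := scaled_zeta.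

Lemma scaled_zetaE t : 0 < t -> w t = 1 + t * (1 - (1 + t) * laplace (@frac_density R) 0 t).
Proof. by move=> t0; rewrite /scaled_zeta zeta_frac//; field; rewrite gt_eqF. Qed.

(** Multiplication by [t] removes the pole. The lower bound keeps all real powers under control, and
    [3 = 1 + 2 * 1] comes from [t < 2]. *)
Lemma scaled_zeta_itv t : I0 t -> 1 <= w t <= 3.
Proof.
move=> /andP[t0 t2]; rewrite scaled_zetaE//.
have := laplace_frac_density_itv t0; set x := (1 + t) * _ => /andP[x0 x1].
have : 0 <= t * (1 - x) by rewrite mulr_ge0 ?subr_ge0 ?(ltW t0).
have : t * (1 - x) <= 2 * 1 by rewrite ler_pM ?subr_ge0 ?(ltW t0) ?(ltW t2)// gerBl.
by move=> h1 h2; apply/andP; split; lra.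
Qed.

Lemma symbol_scaled_zetaB1 k : symbol I0 k 1 (fun t => w t - 1).
Proof.
have sc := symbol_cst oI0; have si := symbol_id oI0 I0_gt0 k.
have le10 : exists K, forall t, I0 t -> t `^ 1 <= K * t `^ 0.
  by exists 2 => t /andP[t0 t2]; rewrite powRr1 ?powRr0 ?mulr1 ltW.
have s1t := symbolD oI0 (sc k 1) (symbol_order I0_gt0 le10 si).
have sG := symbolM oI0 I0_gt0 s1t (symbol_laplace_frac_density k).
rewrite add0r in sG.
have sh := symbolD oI0 (sc k 1) (symbolZ oI0 I0_gt0 (-1) sG).
have := symbolM oI0 I0_gt0 si sh; rewrite addr0; apply: eq_symbol => // t /I0_gt0 t0.
by rewrite scaled_zetaE//; ring.
Qed.

Lemma symbol_r_near0 k alpha : 1 < alpha -> symbol I0 k (1 - alpha) (r alpha).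
Proof.
move=> a1; have sw1 := symbol_scaled_zetaB1 k.
have le10 : exists K, forall t, I0 t -> t `^ 1 <= K * t `^ 0.
  by exists 2 => t /andP[t0 t2]; rewrite powRr1 ?powRr0 ?mulr1 ltW.
have sw : symbol I0 k 0 w.
  apply: eq_symbol (symbolD oI0 (symbol_cst oI0 k 1) (symbol_order I0_gt0 le10 sw1)) => // t _.
  by rewrite addrC subrK.
have sp := symbol_comp_powRB1 oI0 I0_gt0 (ltW a1) scaled_zeta_itv sw sw1.
have := symbolM oI0 I0_gt0 (symbol_powR oI0 I0_gt0 k (- alpha)) sp.
rewrite addrC => sm.
(* A constant has this negative order only because [t] is bounded: [t^(1 - alpha) >= 2^(1 - alpha)]
   on the interval. *)
have sc : symbol I0 k (1 - alpha) (fun=> - 1).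
  apply: symbol_order (symbol_cst oI0 k (-1)) => //.
  exists (2 `^ (alpha - 1)) => t /andP[t0 t2].
  have -> : 1 - alpha = - (alpha - 1) by ring.
  rewrite powRr0 powRN ler_pdivlMr ?powR_gt0// mul1r.
  by rewrite ge0_ler_powR ?nnegrE ?subr_ge0 ?(ltW a1) ?(ltW t0) ?(ltW t2).
apply: eq_symbol (symbolD oI0 sm sc) => // t /[dup] It /I0_gt0 t0.
have z0 : 0 <= zeta (1 + t).
  have /andP[w1 _] := scaled_zeta_itv It.
  by rewrite -(pmulr_rge0 _ t0) (le_trans _ w1).
rewrite /r /scaled_zeta powRM ?(ltW t0)// powRN mulrBr mulrA mulVf ?gt_eqF ?powR_gt0//.
by rewrite mul1r mulr1 addrAC.
Qed.

Lemma symbol_r_infty k alpha : 1 < alpha -> symbol I1 k (- alpha) (r alpha).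
Proof.
move=> a1; have a0 : 0 < alpha by rewrite (lt_trans _ a1).
(* The factor [1 + t] costs one order, so this choice gives [zeta (1 + t) - 1] the order of the
   remaining term [t^(-alpha)]. *)
have sH := symbol_laplace_tail_density k (- alpha - 1).
have le01 : exists K, forall t, I1 t -> t `^ 0 <= K * t `^ 1.
  by exists 1 => t t1; rewrite powRr0 mul1r powRr1 ?(ltW (I1_gt0 t1))//; exact: ltW.
have lea0 : exists K, forall t, I1 t -> t `^ (- alpha) <= K * t `^ 0.
  by exists 1 => t t1; rewrite mul1r ler_powR ?oppr_le0 ?(ltW t1) ?(ltW a0).
have s1t := symbolD oI1 (symbol_order I1_gt0 le01 (symbol_cst oI1 k 1))
  (symbol_id oI1 I1_gt0 k).
have := symbolM oI1 I1_gt0 s1t sH; rewrite addrC subrK => sq.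
have sz1 : symbol I1 k (- alpha) (fun t => zeta (1 + t) - 1).
  by apply: eq_symbol sq => // t /I1_gt0 t0; rewrite zeta_tail// [RHS]addrC addKr.
have sz : symbol I1 k 0 (fun t => zeta (1 + t)).
  apply: eq_symbol (symbolD oI1 (symbol_cst oI1 k 1) (symbol_order I1_gt0 lea0 sz1)) => // t _.
  by rewrite addrC subrK.
have [C [C0 zC]] := symbol_bound sz.
have zitv t : I1 t -> 1 <= zeta (1 + t) <= C.
  move=> t1; have t0 := I1_gt0 t1; apply/andP; split.
    rewrite zeta_tail// lerDl mulr_ge0 ?addr_ge0 ?(ltW t0)//.
    apply: Rintegral_ge0 => y; rewrite RposE => y0.
    by have /andP[? _] := tail_density_itv y0; rewrite expr0 mulr1 mulr_ge0 ?expR_ge0.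
  by have := zC t t1; rewrite powRr0 mulr1; exact/le_trans/ler_norm.
have sp := symbol_comp_powRB1 oI1 I1_gt0 (ltW a1) zitv sz sz1.
apply: eq_symbol (symbolD oI1 sp (symbolZ oI1 I1_gt0 (-1)
  (symbol_powR oI1 I1_gt0 k (- alpha)))) => // t _.
by rewrite /r mulN1r.
Qed.

(** The order is [1 - alpha] near 0 and [- alpha] at infinity. Each may be weakened to the other on
    its own interval, which yields two pure powers valid on the whole half-line. *)
Lemma symbol_r k alpha : 1 < alpha ->
  symbol (@Rpos R) k (- alpha) (r alpha) /\ symbol (@Rpos R) k (1 - alpha) (r alpha).
Proof.
move=> a1; have -> : @Rpos R = I0 `|` I1.
  apply/seteqP; split => t; rewrite RposE.
    by move=> t0; have [t2|t2] := ltP t 2; [left; rewrite /= t0|right; rewrite /=; lra].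
  by move=> [/I0_gt0|/I1_gt0].
split; apply: symbolU.
- apply: symbol_order (symbol_r_near0 k a1) => //; exists 2 => t /andP[t0 t2].
  by rewrite gt0_powRD// powRr1 ?(ltW t0)// ler_wpM2r ?powR_ge0// ltW.
- exact: symbol_r_infty.
- exact: symbol_r_near0.
- apply: symbol_order (symbol_r_infty k a1) => //; exists 1 => t t1.
  by rewrite mul1r ler_powR ?(ltW t1)// lerDr.
Qed.

End r_symbol.

(** * The operator and its derivatives *)

Section L2_facts.
Variable R : realType.
Implicit Types (f h u : R -> R[i]) (g e C x y : R).
Notation mu := (@lebesgue_measure R).

Lemma normcE (z : R[i]) : Normc.normc z = Num.sqrt (complex.Re z ^+ 2 + complex.Im z ^+ 2).
Proof. by case: z. Qed.

Lemma normc_ge0 (z : R[i]) : 0 <= Normc.normc z.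
Proof. by rewrite normcE sqrtr_ge0. Qed.

Lemma normc_sqr (z : R[i]) : Normc.normc z ^+ 2 = complex.Re z ^+ 2 + complex.Im z ^+ 2.
Proof. by rewrite normcE sqr_sqrtr// addr_ge0// sqr_ge0. Qed.

Lemma ler_norm_Re_normc (z : R[i]) : `|complex.Re z| <= Normc.normc z.
Proof. by rewrite normcE -sqrtr_sqr ler_sqrt ?lerDl ?addr_ge0 ?sqr_ge0. Qed.

Lemma ler_norm_Im_normc (z : R[i]) : `|complex.Im z| <= Normc.normc z.
Proof. by rewrite normcE -sqrtr_sqr ler_sqrt ?lerDr ?addr_ge0 ?sqr_ge0. Qed.

Lemma normc_le_ReIm (z : R[i]) : Normc.normc z <= `|complex.Re z| + `|complex.Im z|.
Proof.
rewrite -[leRHS]ger0_norm ?addr_ge0// normcE -sqrtr_sqr ler_sqrt ?sqr_ge0//.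
rewrite sqrrD !real_normK ?num_real// -addrA lerD2l lerDr.
by rewrite mulrn_wge0// mulr_ge0.
Qed.

Lemma Re_mulop (w : R -> R) f x : complex.Re (mulop w f x) = w x * complex.Re (f x).
Proof. by rewrite /mulop; case: (f x) => a b /=; rewrite mul0r subr0. Qed.

Lemma Im_mulop (w : R -> R) f x : complex.Im (mulop w f x) = w x * complex.Im (f x).
Proof. by rewrite /mulop; case: (f x) => a b /=; rewrite mul0r addr0. Qed.

Lemma normc_mulop (w : R -> R) f x : Normc.normc (mulop w f x) = `|w x| * Normc.normc (f x).
Proof.
rewrite !normcE Re_mulop Im_mulop !exprMn -mulrDr sqrtrM ?sqr_ge0//.
by rewrite sqrtr_sqr.
Qed.

Lemma L2normE u : L2norm u =
  ((\int[mu]_(x in @Rpos R) (Normc.normc (u x) ^+ 2)%:E) `^ 2^-1)%E.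
Proof.
rewrite /L2norm unlock; congr (_ `^ _)%E; rewrite [RHS]integral_mkcond.
apply: eq_integral => x _; rewrite !patchE; case: ifP => _.
  by rewrite /= ger0_norm ?normc_ge0// powR_mulrn ?normc_ge0.
by rewrite /= normr0 powR0.
Qed.

Lemma measurable_normc f : measurable_fun (@Rpos R) (fun x => complex.Re (f x)) ->
  measurable_fun (@Rpos R) (fun x => complex.Im (f x)) ->
  measurable_fun (@Rpos R) (fun x => Normc.normc (f x)).
Proof.
move=> mRe mIm.
rewrite (_ : (fun x => _) = (fun x => (complex.Re (f x) ^+ 2 + complex.Im (f x) ^+ 2) `^ 2^-1)).
  apply: (measurableT_comp (measurable_powR _)).
  by apply: measurable_funD; exact: measurable_funX.
by apply/funext => x; rewrite powR12_sqrt ?normcE// addr_ge0 ?sqr_ge0.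
Qed.

Lemma L2_integrable u : L2 u ->
  mu.-integrable (@Rpos R) (fun x => (Normc.normc (u x) ^+ 2)%:E).
Proof.
move=> [mRe mIm]; rewrite L2normE => lt; apply/integrableP; split.
  by apply/measurable_EFinP; apply: measurable_funX; exact: measurable_normc.
under eq_integral do rewrite /= ger0_norm ?sqr_ge0//.
by apply: lty_poweRy lt; rewrite invr_eq0.
Qed.

Lemma eq_L2 f h : (forall x, 0 < x -> f x = h x) -> L2 f -> L2 h.
Proof.
move=> fg [mRe mIm lt]; split.
- by apply: eq_measurable_fun mRe => x; rewrite inE RposE => /fg ->.
- by apply: eq_measurable_fun mIm => x; rewrite inE RposE => /fg ->.
- move: lt; rewrite !L2normE; under eq_integral => x.
    by rewrite inE RposE => /fg ->; over.
  by [].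
Qed.

Lemma eq_L2norm f h : (forall x, 0 < x -> f x = h x) -> L2norm f = L2norm h.
Proof.
move=> fg; rewrite !L2normE; congr (_ `^ _)%E; apply: eq_integral => x.
by rewrite inE RposE => /fg ->.
Qed.

End L2_facts.

(** * Differentiation under the integral sign *)

Section operator.
Variables (R : realType) (alpha rho : R).
Hypotheses (halpha : 1 < alpha) (hrho : rho = (alpha - 1) / 2).
Implicit Types (u : R -> R[i]) (c : R -> R) (g e C t x y : R) (k N : nat).
Notation mu := (@lebesgue_measure R).

Local Notation rk k := (derive1n k (r alpha)).

Lemma is_derive_rk k t : 0 < t -> is_derive t 1 (rk k) (rk k.+1 t).
Proof.
rewrite -RposE => t0; have [sr _] := symbol_r k.+1 halpha.
have d := symbol_derivable sr (ltnSn k) t0.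
by split => //; rewrite derive1nS derive1E.
Qed.

Lemma rk_le k : exists C, 0 <= C /\ forall t, 0 < t -> `|rk k t| <= C * t `^ (- alpha - k%:R).
Proof.
have [sr _] := symbol_r k halpha; have [C [C0 rC]] := symbol_derive1n sr (leqnn k).
by exists C; split => // t; rewrite -RposE; exact: rC.
Qed.

Lemma rk_le_near0 k : exists C, 0 <= C /\ forall t, 0 < t -> `|rk k t| <= C * t `^ (1 - alpha - k%:R).
Proof.
have [_ sr] := symbol_r k halpha; have [C [C0 rC]] := symbol_derive1n sr (leqnn k).
by exists C; split => // t; rewrite -RposE; exact: rC.
Qed.

Definition Tk k c x : R := \int[mu]_(y in @Rpos R) (y `^ rho * rk k (x + y) * c y).

Lemma is_derive_rk_shift k x y : 0 < x + y ->
  is_derive x 1 (fun z => rk k (z + y)) (rk k.+1 (x + y)).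
Proof.
move=> xy; have d : is_derive x (1 : R) (fun z : R => z + y) 1.
  by apply: is_derive_eq (is_deriveD (is_derive_id x 1) (is_derive_cst y x 1)) _; rewrite addr0.
have := is_derive1_comp (g := fun z => z + y) (is_derive_rk k xy) d.
by rewrite mulr1.
Qed.

Lemma measurable_rk_shift k x : 0 < x -> measurable_fun (@Rpos R) (fun y => rk k (x + y)).
Proof.
move=> x0; apply: measurable_fun_Rpos => y y0.
have yx : 0 < y + x by rewrite addr_gt0.
have [+ _] := is_derive_rk_shift k yx.
by under eq_fun do rewrite addrC.
Qed.

Section square_integrable.
Variable c : R -> R.
Hypothesis mc : measurable_fun (@Rpos R) c.
Hypothesis ic : mu.-integrable (@Rpos R) (fun y => (c y ^+ 2)%:E).

(** The product is at most the sum of the squares, and by [2 * rho = alpha - 1] the squared kernel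
    is a beta integrand with [p = alpha] and [q = alpha + 2 * k]. *)
Lemma integrable_envelope k x : 0 < x ->
  mu.-integrable (@Rpos R) (fun y => (y `^ rho * (x + y) `^ (- alpha - k%:R) * c y)%:E).
Proof.
move=> x0; have a0 : 0 < alpha by rewrite (lt_trans _ halpha).
have q0 : 0 < alpha + 2 * k%:R by rewrite ltr_wpDr.
have ib : mu.-integrable (@Rpos R)
    (fun y => (y `^ (alpha - 1) * (x + y) `^ (- alpha - (alpha + 2 * k%:R)))%:E).
  apply/integrableP; split.
    apply/measurable_EFinP; apply: measurable_funM; first exact: measurable_powR_Rpos.
    exact: measurable_powR_shift.
  under eq_integral do rewrite /= ger0_norm ?mulr_ge0 ?powR_ge0//.
  by apply: le_lt_trans (beta_integral_le a0 q0 x0) _; rewrite ltry.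
apply: (le_integrable measurable_Rpos _ _ (integrableD measurable_Rpos ib ic)).
  apply/measurable_EFinP; apply: measurable_funM => //.
  by apply: measurable_funM; [exact: measurable_powR_Rpos|exact: measurable_powR_shift].
move=> y; rewrite RposE => y0; have xy0 : 0 < x + y by rewrite addr_gt0.
rewrite -EFinD lee_fin; apply: le_trans (ler_norm _).
have -> : y `^ (alpha - 1) * (x + y) `^ (- alpha - (alpha + 2 * k%:R)) =
    (y `^ rho * (x + y) `^ (- alpha - k%:R)) ^+ 2.
  have -> : alpha - 1 = rho + rho by rewrite hrho; field.
  have -> : - alpha - (alpha + 2 * k%:R) = (- alpha - k%:R) + (- alpha - k%:R) by ring.
  by rewrite (gt0_powRD rho)// (gt0_powRD (- alpha - k%:R))//; ring.
set p := _ * _ `^ _; rewrite normrM.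
have := sqr_ge0 (`|p| - `|c y|); rewrite sqrrB !real_normK ?num_real// mulr2n.
have : 0 <= `|p| * `|c y| by rewrite mulr_ge0.
lra.
Qed.

Lemma integrable_Tk k x : 0 < x ->
  mu.-integrable (@Rpos R) (fun y => (y `^ rho * rk k (x + y) * c y)%:E).
Proof.
move=> x0; have [C [C0 rC]] := rk_le k.
apply: (le_integrable measurable_Rpos _ _
  (integrableZl measurable_Rpos C (integrable_envelope k x0))).
  apply/measurable_EFinP; apply: measurable_funM => //; apply: measurable_funM.
    exact: measurable_powR_Rpos.
  exact: measurable_rk_shift.
move=> y; rewrite RposE => y0; have xy0 : 0 < x + y by rewrite addr_gt0.
rewrite -EFinM lee_fin !normrM (ger0_norm C0) mulrA ler_wpM2r// mulrCA.
by rewrite ler_wpM2l// (le_trans (rC _ xy0))// ler_wpM2l// ler_norm.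
Qed.

Lemma is_derive_Tk k x : 0 < x -> is_derive x 1 (Tk k c) (Tk k.+1 c x).
Proof.
move=> x0; have [C [C0 rC]] := rk_le k.+1.
pose f s y : R := y `^ rho * rk k (s + y) * c y.
(* The power of [s + y] is decreasing, so for [s > x / 2] its value at [x / 2] dominates. *)
pose G y : R := `|C * (y `^ rho * (x / 2 + y) `^ (- alpha - k.+1%:R) * c y)|.
have x20 : 0 < x / 2 by rewrite divr_gt0.
have df (s y : R) : 0 < s -> 0 < y -> is_derive s 1 (f ^~ y) (y `^ rho * rk k.+1 (s + y) * c y).
  move=> s0 y0; have sy : 0 < s + y by rewrite addr_gt0.
  have d := is_deriveZ (y `^ rho * c y) (is_derive_rk_shift k sy).
  have -> : f ^~ y = (fun z => (y `^ rho * c y) *: rk k (z + y)).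
    by apply/funext => z; rewrite /f /GRing.scale /= mulrAC.
  by apply: is_derive_eq d _; rewrite /GRing.scale /= mulrAC.
have Igt (s : R) : `]x / 2, x + 1[%classic s -> x / 2 < s by rewrite /= in_itv /= => /andP[].
have Igt0 (s : R) : `]x / 2, x + 1[%classic s -> 0 < s by move=> /Igt; exact: lt_trans.
have d1 (s y : R) : 0 < s -> 0 < y -> partial1of2 f s y = y `^ rho * rk k.+1 (s + y) * c y.
  by move=> s0 y0; rewrite partial1of2E; have [_ ->] := df s y s0 y0.
have xI : `]x / 2, x + 1[%classic x.
  by rewrite /= in_itv /=; apply/andP; split; lra.
have fi s : `]x / 2, x + 1[%classic s -> mu.-integrable (@Rpos R) (EFin \o f s).
  by move=> /Igt0; exact: integrable_Tk.
have fd s y : `]x / 2, x + 1[%classic s -> @Rpos R y -> derivable (f ^~ y) s 1.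
  by rewrite RposE => /Igt0 s0 y0; have [] := df s y s0 y0.
have G0 y : 0 <= G y by exact: normr_ge0.
have iG : mu.-integrable (@Rpos R) (EFin \o G).
  exact/integrable_norm/(integrableZl measurable_Rpos C (integrable_envelope k.+1 x20)).
have fG s y : `]x / 2, x + 1[%classic s -> @Rpos R y -> `|partial1of2 f s y| <= G y.
  rewrite RposE => sI y0; have s0 := Igt0 s sI; rewrite d1// /G.
  have sy : 0 < s + y by rewrite addr_gt0.
  have x2y : 0 < x / 2 + y by rewrite addr_gt0.
  rewrite !normrM (ger0_norm C0) mulrA ler_wpM2r// mulrCA ler_wpM2l//.
  apply: le_trans (rC _ sy) _; rewrite ler_wpM2l// ger0_norm ?powR_ge0//.
  rewrite -opprD !powRN lef_pV2 ?posrE ?powR_gt0//.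
  have e0 : 0 <= alpha + k.+1%:R by rewrite addr_ge0// (le_trans ler01)// ltW.
  by rewrite ge0_ler_powR ?nnegrE ?(ltW sy) ?(ltW x2y)// lerD2r ltW// Igt.
split; first exact: (derivable_under_integral measurable_Rpos xI fi fd G0 iG fG).
have := differentiation_under_integral measurable_Rpos xI fi fd G0 iG fG.
rewrite derive1E => ->; rewrite /Tk; apply: eq_Rintegral => y.
by rewrite inE RposE => y0; exact: d1.
Qed.

Lemma is_derive_powR_Tk k x : 0 < x ->
  is_derive x 1 (fun z => z `^ rho * Tk k c z)
    (x `^ rho * Tk k.+1 c x + rho / x * (x `^ rho * Tk k c x)).
Proof.
move=> x0; have h1 := is_derive1_powR rho x0; have h2 := is_derive_Tk k x0.
apply: is_derive_eq (is_deriveM h1 h2) _; rewrite /GRing.scale /=.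
congr (_ + _); rewrite -(powR_subr1 rho x0); field.
by rewrite gt_eqF.
Qed.

End square_integrable.
End operator.

(** * Weighted estimates *)

Section weighted_operator.
Variables (R : realType) (alpha rho : R).
Hypotheses (halpha : 1 < alpha) (hrho : rho = (alpha - 1) / 2).
Implicit Types (u : R -> R[i]) (g e C t x y : R) (k N : nat).
Notation mu := (@lebesgue_measure R).
Local Notation Re := complex.Re.
Local Notation Im := complex.Im.
Local Notation T := (Tk alpha rho).

Lemma L2_ReIm u : L2 u ->
  (measurable_fun (@Rpos R) (fun y => Re (u y)) /\
   mu.-integrable (@Rpos R) (fun y => (Re (u y) ^+ 2)%:E)) /\
  (measurable_fun (@Rpos R) (fun y => Im (u y)) /\
   mu.-integrable (@Rpos R) (fun y => (Im (u y) ^+ 2)%:E)).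
Proof.
move=> u2; have iu := L2_integrable u2; move: u2 => [mRe mIm _].
split; split => //.
- apply: (le_integrable measurable_Rpos _ _ iu).
    by apply/measurable_EFinP; exact: measurable_funX.
  move=> y _; rewrite lee_fin !ger0_norm ?sqr_ge0// normc_sqr lerDl.
  exact: sqr_ge0.
- apply: (le_integrable measurable_Rpos _ _ iu).
    by apply/measurable_EFinP; exact: measurable_funX.
  move=> y _; rewrite lee_fin !ger0_norm ?sqr_ge0// normc_sqr lerDr.
  exact: sqr_ge0.
Qed.

Lemma Rop_Tk u x : L2 u -> 0 < x ->
  Rop alpha rho u x = Complex (x `^ rho * T 0 (fun y => Re (u y)) x)
                              (x `^ rho * T 0 (fun y => Im (u y)) x).
Proof.
move=> /L2_ReIm[[mRe iRe] [mIm iIm]] x0.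
have mD := @measurable_Rpos R.
rewrite /Rop /cintegral /Tk; congr Complex.
- rewrite -RintegralZl//; last exact: (integrable_Tk halpha hrho mRe iRe 0 x0).
  apply: eq_Rintegral => y; rewrite inE RposE => y0.
  by case: (u y) => a b /=; rewrite mul0r subr0 powRM ?(ltW x0) ?(ltW y0)// !mulrA.
- rewrite -RintegralZl//; last exact: (integrable_Tk halpha hrho mIm iIm 0 x0).
  apply: eq_Rintegral => y; rewrite inE RposE => y0.
  by case: (u y) => a b /=; rewrite mul0r addr0 powRM ?(ltW x0) ?(ltW y0)// !mulrA.
Qed.

Lemma near_Rpos (f h : R -> R) x : (forall z, 0 < z -> f z = h z) -> 0 < x ->
  {near x, f =1 h}.
Proof.
by move=> fh x0; near=> z; apply: fh; near: z; exact: lt_nbhsr.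
Unshelve. all: by end_near. Qed.

(** Agreement with the formula is asked on the half-line only, where derivatives are local; this is
    what iterating [P rho] preserves. The term [rho / x] of the product rule is the one that [P]
    subtracts. *)
Lemma cderive_powR_Tk u k (f : R -> R[i]) : L2 u ->
  (forall x, 0 < x -> f x = Complex (x `^ rho * T k (fun y => Re (u y)) x)
                                    (x `^ rho * T k (fun y => Im (u y)) x)) ->
  forall x, 0 < x -> cderivable f x /\
    P rho f x = Complex (x `^ rho * T k.+1 (fun y => Re (u y)) x)
                        (x `^ rho * T k.+1 (fun y => Im (u y)) x).
Proof.
move=> /L2_ReIm[[mRe iRe] [mIm iIm]] fE x x0.
have nRe : {near x, (fun z => z `^ rho * T k (fun y => Re (u y)) z) =1 (fun z => Re (f z))}.
  by apply: near_Rpos => // z z0; rewrite fE.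
have nIm : {near x, (fun z => z `^ rho * T k (fun y => Im (u y)) z) =1 (fun z => Im (f z))}.
  by apply: near_Rpos => // z z0; rewrite fE.
have [dRe eRe] := near_eq_is_derive nRe (is_derive_powR_Tk halpha hrho mRe iRe k x0).
have [dIm eIm] := near_eq_is_derive nIm (is_derive_powR_Tk halpha hrho mIm iIm k x0).
split; first by split.
rewrite /P /cderive !derive1E eRe eIm fE//.
apply/eqP; rewrite eq_complex /=; apply/andP; split; apply/eqP; ring.
Qed.

Lemma iter_P_Rop u k x : L2 u -> 0 < x ->
  iter k (P rho) (Rop alpha rho u) x =
  Complex (x `^ rho * T k (fun y => Re (u y)) x) (x `^ rho * T k (fun y => Im (u y)) x).
Proof.
move=> u2; elim: k x => [|k IHk] x x0; first exact: Rop_Tk.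
by have [_ /= ->] := cderive_powR_Tk u2 IHk x0.
Qed.

Lemma Pdom_Rop u N : L2 u -> Pdom rho N (Rop alpha rho u).
Proof.
move=> u2 k _ x x0.
by have [] := cderive_powR_Tk u2 (fun x => @iter_P_Rop u k x u2) x0.
Qed.

(** * Weight [x^g] on the output, [y^(-e)] on the input *)

Section weights.
Variables (N : nat) (g e C : R).
Local Notation a := (rho + g).
Local Notation b := (rho + e).
Hypotheses (a0 : - 2^-1 < a) (b0 : - 2^-1 < b) (C0 : 0 <= C).
Hypothesis rC : forall t, 0 < t -> `|derive1n N (r alpha) t| <= C * t `^ (- a - b - 1).

(** The power [y^e] extracted from [c] joins [y^rho] to form [y^b], while the symbol bound supplies
    the power of [x + y]. *)
Lemma norm_Tk_le (c V : R -> R) x : measurable_fun (@Rpos R) c ->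
  mu.-integrable (@Rpos R) (fun y => (c y ^+ 2)%:E) ->
  measurable_fun (@Rpos R) V ->
  (forall y, 0 < y -> `|c y| <= y `^ e * V y) -> 0 < x ->
  ((x `^ a * `|T N c x|)%:E <=
   \int[mu]_(y in @Rpos R) (hilbert_kernel a b x y * (C * V y))%:E)%E.
Proof.
move=> mc ic mV cV x0; have mD := @measurable_Rpos R.
have iT := integrable_Tk halpha hrho mc ic N x0.
have hT : (`|T N c x|%:E <=
    \int[mu]_(y in @Rpos R) `|(y `^ rho * derive1n N (r alpha) (x + y) * c y)%:E|)%E.
  have -> : `|T N c x|%:E =
      `|\int[mu]_(y in @Rpos R) (y `^ rho * derive1n N (r alpha) (x + y) * c y)%:E|%E.
    by rewrite -abse_EFin /Tk /Rintegral fineK//; exact: (integrable_fin_num mD iT).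
  by apply: le_abse_integral => //; exact: (measurable_int mu iT).
rewrite EFinM; apply: le_trans (lee_wpmul2l _ hT) _; first by rewrite lee_fin powR_ge0.
rewrite -ge0_integralZl_EFin ?powR_ge0//; last first.
  by apply: measurableT_comp => //; exact: (measurable_int mu iT).
apply: ge0_le_integral => //.
- by move=> y _; rewrite mule_ge0// lee_fin powR_ge0.
- apply: measurable_funeM; apply: measurableT_comp => //.
  exact: (measurable_int mu iT).
- apply/measurable_EFinP; apply: measurable_funM; first exact: measurable_hilbert_kernel.
  by apply: measurable_funM.
- move=> y; rewrite RposE => y0; have xy0 : 0 < x + y by rewrite addr_gt0.
  rewrite -EFinM lee_fin !normrM ger0_norm ?powR_ge0//.
  apply: (@le_trans _ _ (x `^ a * (y `^ rho * (C * (x + y) `^ (- a - b - 1)) * (y `^ e * V y)))).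
    rewrite ler_wpM2l ?powR_ge0// ler_pM ?mulr_ge0 ?powR_ge0 ?cV//.
    by rewrite ler_wpM2l ?powR_ge0 ?rC.
  rewrite /hilbert_kernel (gt0_powRD rho e y0) le_eqVlt; apply/orP; left; apply/eqP.
  by ring.
Qed.

(** Schur's test is applied to the modulus of [v] at once. The factor 2 comes from bounding a
    modulus by the real plus the imaginary part, both controlled by the same [V]. *)
Lemma L2_weighted_Rop u : L2 u -> L2 (mulop (fun y => y `^ (- e)) u) ->
  let v := mulop (fun x => x `^ g) (iter N (P rho) (Rop alpha rho u)) in
  L2 v /\
  (L2norm v <= (2 * C * hilbert_const a b)%:E * L2norm (mulop (fun y => (y `^ (- e))%R) u))%E.
Proof.
move=> u2 ue2 v; have [[mRe iRe] [mIm iIm]] := L2_ReIm u2.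
have mD := @measurable_Rpos R.
pose V y : R := Normc.normc (mulop (fun y => y `^ (- e)) u y).
have mV : measurable_fun (@Rpos R) V by case: ue2 => ? ? _; exact: measurable_normc.
have V0 y : 0 <= V y by exact: normc_ge0.
have uV y : 0 < y -> Normc.normc (u y) = y `^ e * V y.
  move=> y0; rewrite /V normc_mulop ger0_norm ?powR_ge0// mulrA -gt0_powRD// subrr.
  by rewrite powRr0 mul1r.
have ReV y : 0 < y -> `|Re (u y)| <= y `^ e * V y.
  by move=> /uV <-; exact: ler_norm_Re_normc.
have ImV y : 0 < y -> `|Im (u y)| <= y `^ e * V y.
  by move=> /uV <-; exact: ler_norm_Im_normc.
have vRe x : 0 < x -> Re (v x) = x `^ a * T N (fun y => Re (u y)) x.
  by move=> x0; rewrite Re_mulop iter_P_Rop//= addrC gt0_powRD// mulrA.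
have vIm x : 0 < x -> Im (v x) = x `^ a * T N (fun y => Im (u y)) x.
  by move=> x0; rewrite Im_mulop iter_P_Rop//= addrC gt0_powRD// mulrA.
have mT (c : R -> R) : measurable_fun (@Rpos R) c ->
    mu.-integrable (@Rpos R) (fun y => (c y ^+ 2)%:E) ->
    measurable_fun (@Rpos R) (fun x => x `^ a * T N c x).
  move=> mc ic; apply: measurable_funM; first exact: measurable_powR_Rpos.
  by apply: measurable_fun_Rpos => x x0; have [] := is_derive_Tk halpha hrho mc ic N x0.
have mvRe : measurable_fun (@Rpos R) (fun x => Re (v x)).
  by apply: eq_measurable_fun (mT _ mRe iRe) => x; rewrite inE RposE => /vRe ->.
have mvIm : measurable_fun (@Rpos R) (fun x => Im (v x)).
  by apply: eq_measurable_fun (mT _ mIm iIm) => x; rewrite inE RposE => /vIm ->.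
have mv := measurable_normc mvRe mvIm.
have vK x : 0 < x -> ((Normc.normc (v x))%:E <=
    \int[mu]_(y in @Rpos R) (hilbert_kernel a b x y * (2 * C * V y))%:E)%E.
  move=> x0; apply: (@le_trans _ _ (`|Re (v x)| + `|Im (v x)|)%:E).
    by rewrite lee_fin normc_le_ReIm.
  rewrite vRe// vIm// !normrM (ger0_norm (powR_ge0 _ _)) EFinD.
  apply: le_trans (leeD (norm_Tk_le mRe iRe mV ReV x0) (norm_Tk_le mIm iIm mV ImV x0)) _.
  rewrite -ge0_integralD//; last 4 first.
  - by move=> y _; rewrite lee_fin !mulr_ge0 ?powR_ge0.
  - apply/measurable_EFinP; apply: measurable_funM; first exact: measurable_hilbert_kernel.
    by apply: measurable_funM.
  - by move=> y _; rewrite lee_fin !mulr_ge0 ?powR_ge0.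
  - apply/measurable_EFinP; apply: measurable_funM; first exact: measurable_hilbert_kernel.
    by apply: measurable_funM.
  rewrite le_eqVlt; apply/orP; left; apply/eqP; apply: eq_integral => y _.
  by rewrite -EFinD; congr EFin; ring.
have mCV : measurable_fun (@Rpos R) (fun y => 2 * C * V y) by apply: measurable_funM.
have CV0 y : 0 < y -> 0 <= 2 * C * V y by move=> _; rewrite !mulr_ge0.
have v0 x : 0 < x -> 0 <= Normc.normc (v x) by move=> _; exact: normc_ge0.
have hle := schur_hilbert_kernel a0 b0 mCV CV0 mv v0 vK; move: hle.
set h := hilbert_const a b; have h0 : 0 < h by exact: hilbert_const_gt0.
have -> : (\int[mu]_(y in @Rpos R) ((2 * C * V y) ^+ 2)%:E =
    ((2 * C) ^+ 2)%:E * \int[mu]_(y in @Rpos R) (V y ^+ 2)%:E)%E.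
  rewrite -ge0_integralZl_EFin ?sqr_ge0//; last 2 first.
  - by move=> y _; rewrite lee_fin sqr_ge0.
  - by apply/measurable_EFinP; exact: measurable_funX.
  by apply: eq_integral => y _; rewrite exprMn EFinM.
rewrite muleA -EFinM -exprMn => hle.
have le2 : (L2norm v <= (2 * C * h)%:E * L2norm (mulop (fun y => (y `^ (- e))%R) u))%E.
  rewrite !L2normE.
  have -> : (2 * C * h)%:E = (((h * (2 * C)) ^+ 2)%:E `^ 2^-1)%E.
    have hC : 0 <= h * (2 * C) by rewrite mulr_ge0 ?(ltW h0)// mulr_ge0.
    by rewrite poweR_EFin powR12_sqrt ?sqr_ge0// sqrtr_sqr ger0_norm// mulrC.
  have I0 f : (0 <= \int[mu]_(x in @Rpos R) (Normc.normc (f x) ^+ 2)%:E)%E.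
    by apply: integral_ge0 => y _; rewrite lee_fin sqr_ge0.
  rewrite -poweRM ?lee_fin ?sqr_ge0//; apply: gt0_ler_poweR => //.
  - by rewrite in_itv /= I0 leey.
  - by rewrite in_itv /= leey andbT mule_ge0// lee_fin sqr_ge0.
split => //; split => //.
case: ue2 => _ _ uelt; apply: le_lt_trans le2 _.
by rewrite lte_mul_pinfty ?lee_fin// mulr_ge0 ?(ltW h0)// mulr_ge0.
Qed.

End weights.
End weighted_operator.

Theorem lemma5p1 (R : realType) (alpha rho : R) (halpha : 1 < alpha)
    (hrho : rho = (alpha - 1) / 2) :
  (forall (N : nat) (delta : R) (u : R -> R[i]),
      (1 <= N)%N -> 0 <= delta -> delta < alpha / 2 ->
      L2 u ->
      L2 (mulop (fun x : R => x `^ (- N%:R + 1 - delta)) u) ->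
      Pdom rho N (Rop alpha rho u) /\
      L2 (mulop (fun x : R => x `^ (- delta)) (iter N (P rho) (Rop alpha rho u))))
  /\
  (forall N : nat, (1 <= N)%N ->
      exists C : R, forall u : R -> R[i], L2 u ->
        let v := mulop (fun x : R => x ^+ N) (iter N (P rho) (Rop alpha rho u)) in
        [/\ Pdom rho N (Rop alpha rho u), L2 v &
            (L2norm v <= C%:E * L2norm u)%E]).
Proof.
split=> [N delta u N1 d0 d2 u2 ue2|N N1].
  split; first exact: Pdom_Rop.
  have [C [C0 rC]] := rk_le_near0 halpha N.
  have N1R : 1 <= N%:R :> R by rewrite ler1n.
  (* Here [a = rho - delta] and [b = rho + N - 1 + delta], so [a + b + 1 = alpha + N - 1] matches
     the estimate near 0. *)
  have := @L2_weighted_Rop R alpha rho halpha hrho N (- delta) (N%:R - 1 + delta) C.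
  have -> : - (N%:R - 1 + delta) = - N%:R + 1 - delta by ring.
  have -> : - (rho - delta) - (rho + (N%:R - 1 + delta)) - 1 = 1 - alpha - N%:R.
    by rewrite hrho; field.
  move=> /(_ _ _ C0 rC u u2 ue2)[] //.
  - by rewrite hrho; lra.
  - by rewrite hrho; lra.
(* Now [a = rho + N] and [b = rho]: one more power than above, which calls for the estimate with
   [t^(- alpha - N)]. *)
have [C [C0 rC]] := rk_le halpha N.
exists (2 * C * hilbert_const (rho + N%:R) (rho + 0)) => u u2 v.
have u0 : mulop (fun y => y `^ (- 0)) u = u.
  by apply/funext => y; rewrite /mulop oppr0 powRr0 mul1r.
have vE x : 0 < x -> mulop (fun x : R => x `^ N%:R)
    (iter N (P rho) (Rop alpha rho u)) x = v x.
  by move=> x0; rewrite /v /mulop powR_mulrn// ltW.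
have := @L2_weighted_Rop R alpha rho halpha hrho N N%:R 0 C.
have -> : - (rho + N%:R) - (rho + 0) - 1 = - alpha - N%:R by rewrite hrho; field.
have a0 : - 2^-1 < rho + N%:R by rewrite hrho; have := ler0n R N; lra.
have b0 : - 2^-1 < rho + 0 by rewrite hrho; lra.
move=> /(_ a0 b0 C0 rC u u2); rewrite u0 => /(_ u2) [v2 vle].
split; [exact: Pdom_Rop|exact: eq_L2 vE v2|].
by rewrite -(eq_L2norm vE).
Qed.
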